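(* Let $c>1$ and let $a_1\le\cdots\le a_c\le a_{c+1}$ be positive integers such that the Boij–Söderberg decomposition $\beta(a_1,\dots,a_c)=\sum_{s=1}^{\varepsilon}z_s\pi(\mathbf d^s)$ has no instances of mass elimination. Put $a=a_1+\cdots+a_c$ and let $r_1,\dots,r_\varepsilon$ be the remainders defined in the context. If $$a_{c+1}>\max\left\{a,\frac{r_1}{z_1},\dots,\frac{r_\varepsilon}{z_\varepsilon}\right\},$$ then the New Algorithm (described in the context), applied to $\beta(a_1,\dots,a_{c+1})$, produces the Boij–Söderberg decomposition of $\beta(a_1,\dots,a_{c+1})$, i.e. the same decomposition as the Boij–Söderberg (Totally Ordered Decomposition) algorithm.
   Context: Diagrams. A diagram is a finitely supported array $D=(D_{i,j})$ of rational numbers indexed by columns $i\ge 0$ and degrees $j\in\mathbb Z$. For positive integers $a_1\le\dots\le a_m$, $\beta(a_1,\dots,a_m)$ denotes the graded Betti diagram of a complete intersection $S/(f_1,\dots,f_m)$ with $\deg f_i=a_i$ over a standard graded polynomial ring; explicitly $\beta(a_1,\dots,a_m)_{i,j}$ is the number of $i$-element subsets $T\subseteq\{1,\dots,m\}$ with $\sum_{t\in T}a_t=j$. Pure diagrams. A degree sequence is a strictly increasing sequence of integers $\mathbf d=(d_0,\dots,d_m)$; $\mathbf d\le\mathbf d'$ means $d_i\le d_i'$ for all $i$. $\pi(\mathbf d)$ is the diagram with $\pi(\mathbf d)_{i,d_i}=\prod_{k\ne i}\frac1{|d_i-d_k|}$ and all other entries $0$. Boij–Söderberg algorithm (Totally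 Ordered Decomposition Algorithm). Starting with $\beta=\beta(a_1,\dots,a_m)$, repeat: let $\mathbf d$ be the minimal degree sequence, $d_i=\min\{j:\beta_{i,j}\neq0\}$ for $0\le i\le m$; let $q>0$ be the maximal rational such that $\beta-q\pi(\mathbf d)$ has nonnegative entries; replace $\beta$ by $\beta-q\pi(\mathbf d)$; stop when $\beta=0$. This expresses $\beta(a_1,\dots,a_m)$ as $\sum_{s=1}^{\varepsilon}z_s\pi(\mathbf d^s)$ with $\mathbf d^1<\dots<\mathbf d^\varepsilon$ and $z_s>0$, and $\varepsilon$ is the number of steps. The elimination order is the sequence whose $k$-th entry is the set of positions $(i,j)$ whose entry first becomes $0$ at step $k$. Mass elimination occurs if for some $k<\varepsilon$ this set has more than one element. Notation for $\beta^c=\beta(a_1,\dots,a_c)$ without mass elimination. For $1\le s\le\varepsilon-1$, $(i_s,j_s)$ is the unique position eliminated at step $s$; for $s=\varepsilon$ put $(i_\varepsilon,j_\varepsilon)=(c,a)$. For $1\le s\le\varepsilon$: $b_s=(\beta^c)_{i_s,j_s}$ and $p_s=\pi(\mathbf d^s)_{i_s,j_s}$. The remainders are $$r_1=(j_1-a)z_1,\qquad r_k=\frac{j_k-a}{p_k}b_k-\sum_{s=1}^{k-1}\frac{\pi(\mathbf d^s)_{i_k,j_k}}{p_k}r_s\quad(2\le k\le\varepsilon).$$ New Algorithm. With $\beta^{c+1}=\beta(a_1,\dots,a_{c+1})$ and $N=2\varepsilon+c-1$, define sequences $\mathbf e^s=(\mathbf e^s_0,\dots,\mathbf e^s_{c+1})$: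 Phase 1, $1\le s\le\varepsilon$: $\mathbf e^s$ is $\mathbf d^s$ with $a+a_{c+1}$ appended at the end. Phase 2, $s=\varepsilon+k$ with $1\le k\le c-1$: $\mathbf e^{\varepsilon+k}_i=\mathbf e^{\varepsilon+k-1}_i$ for $i\ne c-k+1$, and $\mathbf e^{\varepsilon+k}_{c-k+1}=a_1+\dots+a_{c-k}+a_{c+1}$. (Phase 2 is skipped if $a_c=a_{c+1}$.) Phase 3, $\varepsilon+c\le s\le N$: $\mathbf e^s=(\mathbf e^{N+1-s})^\vee$, where $(\mathbf e^\vee)_k=\mathbf e_{c+1}-\mathbf e_{c+1-k}$ for $0\le k\le c+1$. Starting from $\beta^{c+1}$, run through the values of $s$ in increasing order, at step $s$ subtracting $y_s\pi(\mathbf e^s)$ from the current diagram, where $y_s\in\mathbb Q$ (of any sign) is the unique number making a designated entry zero. The designated entry is: in Phase 1, $(i_s,j_s)$; in Phase 2, for $s=\varepsilon+k$, the position $(c-k,\mathbf e^{\varepsilon+k}_{c-k})$; in Phase 3 with $s<N$, the unique position $(i,\mathbf e^s_i)$ with $\mathbf e^s_i\neq\mathbf e^{s+1}_i$ (the one obtained by reversing the elimination order of $\beta^c$); for $s=N$, the position $(0,0)$. The output is the expression $\sum_s y_s\pi(\mathbf e^s)$. *)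

(* Defs.v *)
(* Mathematical Components. *)
From mathcomp Require Import all_boot all_order all_algebra.

Set Implicit Arguments.
Unset Strict Implicit.
Unset Printing Implicit Defensive.

Import Order.TTheory GRing.Theory Num.Theory.
Local Open Scope ring_scope.

(* Sequences indexed from 1 in mathematical notation (the degrees a_1, a_2,
   ..., the steps of an algorithm) keep this indexing here.  Columns of a
   diagram and entries of a degree sequence are numbered from 0. *)

(* Finite support is not recorded in the type: the diagrams below are Betti
   diagrams of complete intersections minus finitely many multiples of pure
   ones. *)
Definition diagram := nat -> int -> rat.

Definition position := (nat * int)%type.

Definition entry (B : diagram) (p : position) : rat := B p.1 p.2.

Definition degsum (a : nat -> nat) (m : nat) : nat :=
  (\sum_(1 <= t < m.+1) a t)%N.

(* 'I_m is {0, ..., m-1}, whence the shift t.+1. *)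
Definition betti (m : nat) (a : nat -> nat) : diagram := fun i j =>
  #|[set T : {set 'I_m} |
      (#|T| == i) && ((\sum_(t in T) a t.+1)%N%:Z == j)]|%:R.

Definition degree_sequence (m : nat) (d : seq int) : Prop :=
  size d = m.+1 /\ sorted <%R d.

Definition pure (d : seq int) : diagram := fun i j =>
  if (i < size d)%N && (j == d`_i)
  then \prod_(k < size d | k != i :> nat) (`|d`_i - d`_k|%:Q)^-1
  else 0.

(* The formal sum \sum_s z_s pi(d^s), as the list of the pairs (z_s, d^s). *)
Definition decomposition := seq (rat * seq int).

Definition coef (l : decomposition) (s : nat) : rat := (nth (0, [::]) l s.-1).1.
Definition degs (l : decomposition) (s : nat) : seq int :=
  (nth (0, [::]) l s.-1).2.

(* The diagram left after subtracting the first n terms of l from B. *)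
Definition residual (B : diagram) (l : decomposition) (n : nat) : diagram :=
  fun i j => B i j - \sum_(t <- take n l) t.1 * pure t.2 i j.

Definition minimal_degree_sequence (m : nat) (B : diagram) (d : seq int) : Prop :=
  degree_sequence m d /\
  forall i, (i <= m)%N -> B i d`_i != 0 /\ forall j, B i j != 0 -> d`_i <= j.

Definition leaves_nonneg (B : diagram) (d : seq int) (q : rat) : Prop :=
  forall i j, 0 <= B i j - q * pure d i j.

Definition maximal_coef (B : diagram) (d : seq int) (q : rat) : Prop :=
  [/\ 0 < q, leaves_nonneg B d q
    & forall q', leaves_nonneg B d q' -> q' <= q].

(* l is the list of steps of the Totally Ordered Decomposition Algorithm on a
   diagram B with columns 0, ..., m. *)
Definition bs_decomposition (m : nat) (B : diagram) (l : decomposition) : Prop :=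
  (forall s, (1 <= s <= size l)%N ->
     minimal_degree_sequence m (residual B l s.-1) (degs l s) /\
     maximal_coef (residual B l s.-1) (degs l s) (coef l s)) /\
  (forall i j, residual B l (size l) i j = 0).

Definition eliminated (B : diagram) (l : decomposition) (k : nat)
    (p : position) : Prop :=
  entry (residual B l k) p = 0 /\
  forall t, (t < k)%N -> entry (residual B l t) p <> 0.

Definition mass_elimination (B : diagram) (l : decomposition) : Prop :=
  exists2 k, (1 <= k < size l)%N &
  exists p q, [/\ p <> q, eliminated B l k p & eliminated B l k q].

(* In the remaining definitions l is the decomposition of betti c a, so that
   size l is epsilon, and pos s is the position (i_s, j_s). *)

Definition elimination_positions (c : nat) (a : nat -> nat) (l : decomposition)
    (pos : nat -> position) : Prop :=
  (forall s, (1 <= s < size l)%N -> eliminated (betti c a) l s (pos s)) /\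
  pos (size l) = (c, (degsum a c)%:Z).

Definition remainders (c : nat) (a : nat -> nat) (l : decomposition)
    (pos : nat -> position) (r : nat -> rat) : Prop :=
  let b s := entry (betti c a) (pos s) in
  let p s := entry (pure (degs l s)) (pos s) in
  let shift s := ((pos s).2 - (degsum a c)%:Z)%:~R : rat in
  r 1%N = shift 1%N * coef l 1 /\
  forall k, (2 <= k <= size l)%N ->
    r k = shift k / p k * b k
          - \sum_(1 <= s < k) entry (pure (degs l s)) (pos k) / p k * r s.

Definition dual (e : seq int) : seq int :=
  let m := (size e).-1 in mkseq (fun k => e`_m - e`_(m - k)) (size e).

Definition phase1_degs (c : nat) (a : nat -> nat) (l : decomposition)
    (s : nat) : seq int :=
  rcons (degs l s) (degsum a c.+1)%:Z.

(* e^(epsilon + k) *)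
Fixpoint phase2_degs (c : nat) (a : nat -> nat) (l : decomposition)
    (k : nat) : seq int :=
  match k with
  | 0%N => phase1_degs c a l (size l)
  | k'.+1 => set_nth 0 (phase2_degs c a l k') (c - k + 1)%N
               (degsum a (c - k) + a c.+1)%N%:Z
  end.

Definition last_step (c : nat) (l : decomposition) : nat :=
  (2 * size l + c - 1)%N.

(* e^s *)
Definition new_degs (c : nat) (a : nat -> nat) (l : decomposition)
    (s : nat) : seq int :=
  if (s <= size l)%N then phase1_degs c a l s
  else if (s < size l + c)%N then phase2_degs c a l (s - size l)
  else dual (phase1_degs c a l (last_step c l + 1 - s)).

(* p is the entry to be made zero at step s. *)
Definition designated (c : nat) (a : nat -> nat) (l : decomposition)
    (pos : nat -> position) (s : nat) (p : position) : Prop :=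
  let e := new_degs c a l in
  if (s <= size l)%N then p = pos s
  else if (s < size l + c)%N then
    let k := (s - size l)%N in p = ((c - k)%N, (e s)`_(c - k))
  else if (s < last_step c l)%N then
    [/\ (p.1 <= c.+1)%N, p.2 = (e s)`_(p.1)
      & forall i, (i <= c.+1)%N -> (e s)`_i <> (e s.+1)`_i <-> i = p.1]
  else p = (0%N, 0).

Definition new_steps (c : nat) (a : nat -> nat) (l : decomposition) : seq nat :=
  iota 1 (size l)
  ++ (if a c == a c.+1 then [::] else iota (size l).+1 c.-1)
  ++ iota (size l + c) (size l).

(* out is the output \sum_s y_s pi(e^s) of the New Algorithm on betti c.+1 a:
   its n-th term is the one subtracted at the n-th step performed, and y_s is
   required to be the only number making the designated entry zero. *)
Definition new_algorithm (c : nat) (a : nat -> nat) (l : decomposition)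
    (pos : nat -> position) (out : decomposition) : Prop :=
  let steps := new_steps c a l in
  size out = size steps /\
  forall n, (1 <= n <= size steps)%N ->
    let s := nth 0%N steps n.-1 in
    degs out n = new_degs c a l s /\
    exists2 p, designated c a l pos s p &
      forall y : rat,
        entry (residual (betti c.+1 a) out n.-1) p
          - y * entry (pure (new_degs c a l s)) p = 0
        <-> y = coef out n.

(* Main.v *)
Require Import Defs.
From mathcomp Require Import all_boot all_order all_algebra.
From mathcomp Require Import ring zify.
Import Order.TTheory GRing.Theory Num.Theory.
Local Open Scope ring_scope.

Set Implicit Arguments.
Unset Strict Implicit.
Unset Printing Implicit Defensive.

(* Write al = a_(c+1), A = a_1 + ... + a_c, D = A + al and beta = beta(a_1..a_c).
   Phase 1 forces the coefficients y_s = al z_s - r_s, because the r_s solve the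
   triangular system sum_s r_s pi(d^s) = (j_k - A) beta at the eliminated
   positions (i_k, j_k); they are positive by hypothesis.  What Phase 1 leaves
   below degree al is G_(i,j) / (D - j), where
   G_(i,j) = (A - j) beta_(i,j) + sum_s r_s pi(d^s)_(i,j) lives on the top degrees
   m_0 < ... < m_(c-1) of the columns of beta.  The Herzog-Kuehl equations make G
   a multiple C pi(m_0, ..., m_(c-1)), and the moment of order c of beta gives
   C = c! a_1 ... a_c > 0.  A telescoping identity of divided differences writes
   the remaining diagram with the Phase 2 coefficients C (al + n_j - m_j) > 0,
   n_j = a_1 + ... + a_j.  High degrees follow by duality, and the two corners by
   one more Herzog-Kuehl equation.  Finally, in a positive combination of pure
   diagrams along a chain of degree sequences that changes one column at a time,
   every step of either algorithm is determined by the chain. *)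

(** * Betti diagrams *)

(** Subsets of ['I_m.+1] are split by whether they contain the last index. The summand sees only the
    size and the degree sum, so the lemma serves both the recursion for Betti numbers and the
    alternating sums below. *)
Lemma sum_setS (V : nmodType) (m : nat) (a : nat -> nat) (F : nat -> nat -> V) :
  \sum_(T : {set 'I_m.+1}) F #|T| (\sum_(t in T) a t.+1)%N =
  \sum_(T : {set 'I_m}) F #|T| (\sum_(t in T) a t.+1)%N +
  \sum_(T : {set 'I_m}) F #|T|.+1 (\sum_(t in T) a t.+1 + a m.+1)%N.
Proof.
pose w := widen_ord (leqnSn m).
have wI : injective w by move=> x y /(congr1 val) /= /val_inj.
have wN (x : 'I_m) : w x != ord_max by rewrite -val_eqE /= neq_ltn ltn_ord.
have Sw (T : {set 'I_m}) :
    (\sum_(t in w @: T) a t.+1 = \sum_(t in T) a t.+1)%N.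
  by rewrite big_imset //= => x y _ _; apply: wI.
have pw (T : {set 'I_m}) : w @^-1: (w @: T) = T.
  by apply/setP => x; rewrite inE mem_imset.
have Nw (T : {set 'I_m}) : ord_max \notin w @: T.
  by apply/imsetP => -[x _ /esym/eqP]; apply/negP.
have pre (T : {set 'I_m.+1}) : ord_max \notin T -> w @: (w @^-1: T) = T.
  move=> Tm; apply/setP => x; apply/imsetP/idP => [[y]|xT].
    by rewrite inE => yT ->.
  have xm : (x < m)%N.
    rewrite ltn_neqAle -ltnS ltn_ord andbT.
    by apply: contraNneq Tm => xm; rewrite (_ : ord_max = x) //; apply: val_inj.
  exists (Ordinal xm); last exact: val_inj.
  by rewrite inE (_ : w _ = x) //; apply: val_inj.
rewrite (bigID (fun T : {set 'I_m.+1} => ord_max \in T)) [LHS]addrC /=.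
congr (_ + _).
  rewrite (reindex_onto (fun T : {set 'I_m} => w @: T)
    (fun T => w @^-1: T)) //=.
  apply: eq_big => [T|T _]; first by rewrite Nw pw eqxx.
  by rewrite Sw card_imset.
rewrite (reindex_onto (fun T : {set 'I_m} => ord_max |: w @: T)
  (fun T => w @^-1: (T :\ ord_max))) /=; last first.
  by move=> T mT; rewrite pre ?setD11 // setD1K.
apply: eq_big => [T|T _]; first by rewrite setU11 setU1K // pw eqxx.
by rewrite cardsU1 Nw card_imset // big_setU1 //= Sw add1n addnC.
Qed.

Lemma degsumS (a : nat -> nat) (m : nat) :
  degsum a m.+1 = (degsum a m + a m.+1)%N.
Proof. by rewrite /degsum big_nat_recr. Qed.

Lemma degsum_le (a : nat -> nat) (m n : nat) :
  (m <= n)%N -> (degsum a m <= degsum a n)%N.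
Proof.
move=> mn; rewrite -(subnKC mn); elim: (n - m)%N => [|k IH].
  by rewrite addn0.
by rewrite addnS degsumS; lia.
Qed.

Lemma bettiE (m : nat) (a : nat -> nat) (i : nat) (j : int) :
  betti m a i j =
  \sum_(T : {set 'I_m}) ((#|T| == i) && ((\sum_(t in T) a t.+1)%N%:Z == j))%:R.
Proof.
rewrite /betti -sum1_card natr_sum big_mkcond /=.
by apply: eq_bigr => T _; rewrite inE; case: ifP.
Qed.

Lemma betti0 (a : nat -> nat) (i : nat) (j : int) :
  betti 0 a i j = ((i == 0%N) && (j == 0))%:R.
Proof.
rewrite bettiE (big_pred1 set0) => [|T].
  by rewrite cards0 big_set0 eq_sym; congr (nat_of_bool (_ && _))%:R; rewrite eq_sym.
by symmetry; apply/eqP/setP => -[].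
Qed.

Lemma betti_ge0 (m : nat) (a : nat -> nat) (i : nat) (j : int) :
  0 <= betti m a i j.
Proof. exact: ler0n. Qed.

(** Tensoring with the Koszul complex of one more form adds a copy moved by one column and [a m.+1]
    degrees. *)
Lemma bettiS (m : nat) (a : nat -> nat) (i : nat) (j : int) :
  betti m.+1 a i j =
  betti m a i j + (if i is i'.+1 then betti m a i' (j - (a m.+1)%:Z) else 0).
Proof.
rewrite bettiE (@sum_setS _ m a (fun x y => ((x == i) && (y%:Z == j))%:R)) bettiE.
congr (_ + _); case: i => [|i]; first exact: big1.
rewrite bettiE; apply: eq_bigr => T _; rewrite eqSS PoszD.
by congr (nat_of_bool (_ && _))%:R; apply/eqP/eqP; lia.
Qed.

(** For nondecreasing degrees the largest sum of [i] of them is the sum of the last [i], which is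
    the upper bound given here. *)
Lemma betti_neq0 (m : nat) (a : nat -> nat) (i : nat) (j : int) :
  (forall t, (1 <= t < m)%N -> (a t <= a t.+1)%N) ->
  betti m a i j != 0 ->
  [/\ (i <= m)%N, 0 <= j & j <= (degsum a m)%:Z - (degsum a (m - i))%:Z].
Proof.
elim: m i j => [|m IH] i j a_le.
  by rewrite betti0; case: i => [|i] //=; case: (j =P 0) => //= -> _; rewrite subrr.
have a_mono k : (k <= m)%N -> (a (m.+1 - k) <= a m.+1)%N.
  elim: k => [|k IHk] km; first by rewrite subn0.
  apply: leq_trans (IHk _); last by lia.
  have -> : (m.+1 - k = (m.+1 - k.+1).+1)%N by lia.
  by apply: a_le; lia.
have {}IH i' j' := IH i' j' (fun t ht => a_le t ltac:(lia)).
rewrite bettiS; case: (eqVneq (betti m a i j) 0) => [->|/IH[im j0 jm] _].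
  rewrite add0r; case: i => [|i]; first by rewrite eqxx.
  move=> /IH[im j0 jm]; rewrite subSS degsumS; split; lia.
split; [lia | lia |].
have := a_mono _ im; rewrite subSn // !degsumS; lia.
Qed.

Lemma betti_max (m : nat) (a : nat -> nat) (i : nat) :
  (i <= m)%N -> betti m a i ((degsum a m)%:Z - (degsum a (m - i))%:Z) != 0.
Proof.
elim: m i => [|m IH] [|i] // im.
- by rewrite betti0 subrr.
- by have := IH 0%N isT; rewrite bettiS !subn0 !subrr addr0.
- rewrite bettiS subSS; apply: lt0r_neq0; apply: ltr_wpDl; first exact: betti_ge0.
  rewrite lt0r betti_ge0 andbT degsumS.
  by rewrite (_ : _ - _ = (degsum a m)%:Z - (degsum a (m - i))%:Z) ?IH //; lia.
Qed.

(** Complementing subsets gives the self-duality of the Koszul complex. *)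
Lemma betti_dual (m : nat) (a : nat -> nat) (i : nat) (j : int) :
  (i <= m)%N -> betti m a (m - i)%N ((degsum a m)%:Z - j) = betti m a i j.
Proof.
move=> im; rewrite !bettiE (reindex_inj (@setC_inj _)) /=; apply: eq_bigr => T _.
have sT : ((\sum_(t in T) a t.+1) + \sum_(t in ~: T) a t.+1 = degsum a m)%N.
  rewrite /degsum big_add1 /= big_mkord [RHS](bigID (mem T)) /=; congr (_ + _)%N.
  by apply: eq_bigl => t; rewrite inE.
have cT := cardsC T; rewrite card_ord in cT.
move: sT cT; set x := (\sum_(t in T) _)%N; set y := (\sum_(t in _) _)%N.
set u := #|T|; set v := #|~: T|; move: x y u v => x y u v ? ?.
by congr (nat_of_bool (_ && _))%:R; apply/eqP/eqP; lia.
Qed.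
(** * Finite differences and divided differences *)

(** The difference operator lowers the degree by one and multiplies the leading coefficient by
    [k.+1 * h]. Read at larger [k], the formula also gives the drop in degree. *)
Lemma coef_shift_sub (p : {poly rat}) (h : rat) (k : nat) :
  (size p <= k.+2)%N ->
  ((p \Po ('X + h%:P)) - p)`_k = k.+1%:R * h * p`_k.+1.
Proof.
elim/poly_ind: p k => [|q c IH] k sp.
  by rewrite comp_poly0 subr0 !coef0 mulr0.
have sq : (size q <= k.+1)%N.
  by apply/leq_sizeP => i ki; have /leq_sizeP/(_ i.+1 ki) := sp;
     rewrite coefD coefMX coefC /= addr0.
rewrite comp_polyD comp_polyM comp_polyX comp_polyC.
set q' := q \Po _ in IH *.
(* A discrete product rule for [q * 'X]. *)
have -> : q' * ('X + h%:P) + c%:P - (q * 'X + c%:P) =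
  (q' - q) * 'X + h *: q + h *: (q' - q).
  by rewrite -!mul_polyC mulrDr mulrBl mulrBr opprD !addrA; ring.
have qk : (q' - q)`_k = 0.
  by rewrite (IH k (leqW sq)) (leq_sizeP _ _ sq k.+1) ?mulr0.
rewrite !coefD !coefZ qk !coefMX coefC /= mulr0 !addr0.
case: k sp sq qk => [|k] sp sq qk; first by rewrite add0r mul1r.
by rewrite (IH k sq) -[k.+2%:R]natr1 /=; ring.
Qed.

(** Up to the sign [(-1) ^+ m], the left side is the composite of the [m] difference operators with
    steps [a 1], ..., [a m], evaluated at 0. On degree at most [m] only the top coefficient
    survives. *)
Lemma sum_sign_horner (m : nat) (a : nat -> nat) (p : {poly rat}) :
  (size p <= m.+1)%N ->
  \sum_(T : {set 'I_m}) (-1) ^+ #|T| * p.[(\sum_(t in T) a t.+1)%N%:R] =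
  (-1) ^+ m * (m`! * \prod_(t < m) a t.+1)%N%:R * p`_m.
Proof.
elim: m p => [|m IH] p sp.
  rewrite (big_pred1 set0) => [|T].
    rewrite cards0 !big_set0 big_ord0 (size1_polyC sp) hornerC coefC /=.
    by rewrite !mul1r.
  by symmetry; apply/eqP/setP => -[].
rewrite (@sum_setS _ m a (fun x y => (-1) ^+ x * p.[y%:R])).
set h : rat := (a m.+1)%:R; pose q := (p \Po ('X + h%:P)) - p.
have sq : (size q <= m.+1)%N.
  apply/leq_sizeP => k mk; rewrite coef_shift_sub; last by lia.
  by rewrite (leq_sizeP _ _ sp) ?mulr0.
transitivity (- \sum_(T : {set 'I_m})
    (-1) ^+ #|T| * q.[(\sum_(t in T) a t.+1)%N%:R]).
  rewrite -sumrN -big_split /=; apply: eq_bigr => T _.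
  by rewrite hornerD hornerN horner_comp !hornerE natrD exprS -/h mulrBr; ring.
rewrite IH // coef_shift_sub // factS big_ord_recr /= !natrM exprS -/h.
by move: (\prod_(i < m) _)%N%:R => z; ring.
Qed.

Lemma prod_XsubC_neq (n : nat) (x : nat -> rat) (i : 'I_n.+1) :
  \prod_(k < n.+1 | k != i) ('X - (x k)%:P) \is monic /\
  size (\prod_(k < n.+1 | k != i) ('X - (x k)%:P)) = n.+1.
Proof.
split; first by apply: monic_prod => k _; apply: monicXsubC.
rewrite size_prod => [|k _]; last by rewrite polyXsubC_eq0.
rewrite (eq_bigr (fun=> 2%N)) => [|k _]; last by rewrite size_XsubC.
by rewrite sum_nat_const cardC1 card_ord /=; lia.
Qed.

(** The sum is the divided difference of [f] at [n.+1] nodes, that is, the coefficient of degree [n]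
    of the Lagrange interpolant [g]. Since [f] has degree below [n], the interpolant is [f] and this
    coefficient is 0. *)
Lemma sum_lagrange0 (n : nat) (x : nat -> rat) (f : {poly rat}) :
  (forall i k, (i <= n)%N -> (k <= n)%N -> x i = x k -> i = k) ->
  (size f <= n)%N ->
  \sum_(i < n.+1) f.[x i] * \prod_(k < n.+1 | k != i) (x i - x k)^-1 = 0.
Proof.
move=> xI sf; pose P (i : 'I_n.+1) := \prod_(k < n.+1 | k != i) ('X - (x k)%:P).
pose w (i : 'I_n.+1) := \prod_(k < n.+1 | k != i) (x i - x k)^-1.
pose g := \sum_(i < n.+1) (f.[x i] * w i) *: P i.
have Pi (i : 'I_n.+1) : w i * (P i).[x i] = 1.
  rewrite horner_prod -big_split /= big1 // => k ki.
  rewrite hornerXsubC mulVf // subr_eq0; apply: contra ki => /eqP /xI e.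
  by apply/eqP/val_inj; rewrite /= e // -ltnS.
have Pk (i k : 'I_n.+1) : k != i -> (P i).[x k] = 0.
  by move=> ki; rewrite horner_prod (bigD1 k) //= hornerXsubC subrr mul0r.
have sg : (size g <= n.+1)%N.
  apply: leq_trans (size_sum _ _ _) _; apply/bigmax_leqP => i _.
  by apply: leq_trans (size_scale_leq _ _) _; rewrite (prod_XsubC_neq x i).2.
(* Otherwise [g - f] is nonzero of size at most [n.+1] and has [n.+1] distinct roots. *)
have gE : g = f.
  apply/eqP; rewrite -subr_eq0; apply/negPn/negP => gf.
  have /(max_poly_roots gf) : all (root (g - f)) [seq x i | i : 'I_n.+1].
    apply/allP => _ /mapP[i _ ->]; rewrite /root hornerD hornerN horner_sum.
    rewrite (bigD1 i) //= big1 ?addr0 => [|k ki].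
      by rewrite hornerZ -mulrA Pi mulr1 subrr.
    by rewrite hornerZ Pk ?mulr0 1?eq_sym.
  rewrite map_inj_uniq ?enum_uniq => [|i k]; last first.
    by move=> /xI e; apply/val_inj; rewrite /= e // -ltnS.
  move=> /(_ isT); rewrite size_map size_enum_ord ltnNge => /negP; apply.
  by apply: leq_trans (size_polyD _ _) _; rewrite size_polyN geq_max sg leqW.
transitivity f`_n; last exact: (leq_sizeP _ _ sf n (leqnn n)).
rewrite -[in RHS]gE coef_sum.
apply: eq_bigr => i _; rewrite coefZ.
have [/monicP m s] := prod_XsubC_neq x i.
by move: m; rewrite /lead_coef s /= -/(P i) => ->; rewrite mulr1.
Qed.

(** * Pure diagrams and moments *)

Lemma degree_sequence_lt (m : nat) (d : seq int) (i k : nat) :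
  degree_sequence m d -> (i < k)%N -> (k <= m)%N -> d`_i < d`_k.
Proof.
move=> [sd ltd] ik km; rewrite lt_sorted_ltn_nth // !inE sd; lia.
Qed.

Lemma degree_sequence_inj (m : nat) (d : seq int) (i k : nat) :
  degree_sequence m d -> (i <= m)%N -> (k <= m)%N -> d`_i = d`_k -> i = k.
Proof.
move=> dd im km e.
case: (ltngtP i k) => // [ik|ki].
  by have := degree_sequence_lt dd ik km; rewrite e ltxx.
by have := degree_sequence_lt dd ki im; rewrite e ltxx.
Qed.

Lemma pure_eq0 (d : seq int) (i : nat) (j : int) : j != d`_i -> pure d i j = 0.
Proof. by rewrite /pure => /negbTE ->; rewrite andbF. Qed.

Lemma pure_ge0 (d : seq int) (i : nat) (j : int) : 0 <= pure d i j.
Proof.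
rewrite /pure; case: ifP => // _.
by apply: prodr_ge0 => k _; rewrite invr_ge0 ler0z.
Qed.

Lemma pure_gt0 (m : nat) (d : seq int) (i : nat) :
  degree_sequence m d -> (i <= m)%N -> 0 < pure d i d`_i.
Proof.
move=> dd im; have [sd _] := dd.
rewrite /pure sd ltnS im eqxx /=; apply: prodr_gt0 => k ki.
rewrite invr_gt0 ltr0z normr_gt0 subr_eq0.
apply: contra ki => /eqP /(degree_sequence_inj dd im) -> //.
by rewrite -ltnS.
Qed.

(** Appending [D] contributes one new factor to each old column. This relates the Phase 1 pure
    diagrams to those of [betti c a]. *)
Lemma pure_rcons (d : seq int) (D : int) (i : nat) (j : int) :
  (i < size d)%N -> (forall k, (k < size d)%N -> d`_k < D) ->
  pure (rcons d D) i j = pure d i j / (D - j)%:~R.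
Proof.
move=> id dD; rewrite /pure size_rcons ltnS (ltnW id) id nth_rcons id /=.
case: eqP => [->|_]; last by rewrite mul0r.
rewrite big_mkcond big_ord_recr /= neq_ltn id orbT -big_mkcond /=.
rewrite nth_rcons ltnn eqxx; congr (_ * _ ^-1).
  by apply: eq_bigr => k _; rewrite nth_rcons ltn_ord.
by have := dD i id => dDi; congr (_ %:~R); rewrite distrC gtr0_norm ?subr_gt0.
Qed.

Lemma size_dual (d : seq int) : size (dual d) = size d.
Proof. exact: size_mkseq. Qed.

Lemma nth_dual (m : nat) (d : seq int) (i : nat) :
  size d = m.+1 -> (i <= m)%N -> (dual d)`_i = d`_m - d`_(m - i).
Proof. by move=> sd im; rewrite /dual sd nth_mkseq. Qed.

Lemma degree_sequence_dual (m : nat) (d : seq int) :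
  degree_sequence m d -> degree_sequence m (dual d).
Proof.
move=> dd; have [sd _] := dd; split; first by rewrite size_dual.
apply/(sortedP 0) => i; rewrite size_dual sd ltnS => im.
rewrite !(nth_dual sd) //; last exact: ltnW.
by rewrite ltrD2l ltrN2; apply: (degree_sequence_lt dd); lia.
Qed.

Lemma pure_dual (m : nat) (d : seq int) (i : nat) (j : int) :
  size d = m.+1 -> (i <= m)%N ->
  pure (dual d) i j = pure d (m - i)%N (d`_m - j).
Proof.
move=> sd im; rewrite /pure size_dual sd ltnS im ltnS leq_subr /=.
rewrite (nth_dual sd im).
have -> : (j == d`_m - d`_(m - i)) = (d`_m - j == d`_(m - i)).
  by apply/eqP/eqP; lia.
case: eqP => // _; rewrite (reindex_inj rev_ord_inj) /=.
apply: eq_big => [k|k _].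
  by have km := ltn_ord k; congr (~~ _); apply/eqP/eqP; lia.
rewrite (nth_dual sd); last by rewrite subSS leq_subr.
have -> : (m - (m.+1 - k.+1) = k)%N by have := ltn_ord k; lia.
rewrite [in RHS]distrC; congr (`|_|%:~R ^-1).
by rewrite opprB [LHS]addrC addrA subrK.
Qed.

(** Without absolute values the product is a divided-difference weight. The [m - i] factors with
    [k > i] are the negative ones. *)
Lemma pure_sign (m : nat) (d : seq int) (i : nat) :
  degree_sequence m d -> (i <= m)%N ->
  pure d i d`_i =
  (-1) ^+ (m - i) *
  \prod_(k < m.+1 | k != i :> nat) ((d`_i)%:~R - (d`_k)%:~R)^-1.
Proof.
move=> dd im; have [sd _] := dd.
rewrite /pure sd ltnS im eqxx /=.
have -> : (m - i = \sum_(k < m.+1 | k != i :> nat) (i < k))%N.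
  rewrite big_mkcond /=.
  transitivity (\sum_(k < m.+1) (i < k))%N.
    elim: m {dd sd} im => [|m IH] im; first by rewrite big_ord1 ltn0 sub0n.
    rewrite big_ord_recr /=.
    case: (leqP i m) => [im'|mi]; first by rewrite -IH //; lia.
    rewrite big1 => [|k _]; first by lia.
    by have := ltn_ord k; lia.
  by apply: eq_bigr => k _; case: eqP => [->|//]; rewrite ltnn.
rewrite expr_sum -big_split /=; apply: eq_bigr => k ki.
rewrite -intrB; case: (ltnP i k) => ik.
  rewrite ltr0_norm ?intrN ?invrN ?expr1 ?mulN1r // subr_lt0.
  by apply: (degree_sequence_lt dd ik); have := ltn_ord k.
rewrite mul1r gtr0_norm // subr_gt0; apply: (degree_sequence_lt dd) => //.
by rewrite ltn_neqAle ki.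
Qed.

(** * Moments and the Herzog-Kuehl equations *)

Definition moment (m J : nat) (f : {poly rat}) (B : diagram) : rat :=
  \sum_(i < m.+1) \sum_(j < J) (-1) ^+ i * f.[j%:R] * B i j%:Z.

Lemma moment_ext (m J : nat) (f : {poly rat}) (B B' : diagram) :
  (forall i j, B i j = B' i j) -> moment m J f B = moment m J f B'.
Proof.
by move=> BB; apply: eq_bigr => i _; apply: eq_bigr => j _; rewrite BB.
Qed.

Lemma momentD (m J : nat) (f : {poly rat}) (B B' : diagram) :
  moment m J f (fun i j => B i j + B' i j) = moment m J f B + moment m J f B'.
Proof.
rewrite -big_split; apply: eq_bigr => i _; rewrite -big_split /=.
by apply: eq_bigr => j _; rewrite mulrDr.
Qed.

Lemma momentZ (m J : nat) (f : {poly rat}) (z : rat) (B : diagram) :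
  moment m J f (fun i j => z * B i j) = z * moment m J f B.
Proof.
rewrite /moment mulr_sumr; apply: eq_bigr => i _; rewrite mulr_sumr.
by apply: eq_bigr => j _; rewrite mulrCA.
Qed.

Lemma moment_sum (m J : nat) (f : {poly rat}) (I : Type) (s : seq I)
    (P : pred I) (B : I -> diagram) :
  moment m J f (fun i j => \sum_(t <- s | P t) B t i j) =
  \sum_(t <- s | P t) moment m J f (B t).
Proof.
rewrite /moment [RHS]exchange_big; apply: eq_bigr => i _.
rewrite [RHS]exchange_big; apply: eq_bigr => j _; exact: mulr_sumr.
Qed.

Lemma moment_col (m J : nat) (f : {poly rat}) (B : diagram) (d : nat -> nat) :
  (forall i, (i <= m)%N -> (d i < J)%N) ->
  (forall i j, (i <= m)%N -> j != (d i)%:Z -> f.[j%:~R] * B i j = 0) ->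
  moment m J f B =
  \sum_(i < m.+1) (-1) ^+ i * f.[(d i)%:R] * B i (d i)%:Z.
Proof.
move=> dJ Bd; apply: eq_bigr => i _; have im : (i <= m)%N by rewrite -ltnS.
rewrite (bigD1 (Ordinal (dJ i im))) //= big1 ?addr0 // => j ji.
rewrite -mulrA (Bd i j%:Z im) ?mulr0 //; apply: contra ji => /eqP [e].
Qed.

(** These are the Herzog-Kuehl equations: the sign of column [i] and the sign in [pure_sign]
    multiply to the constant [(-1) ^+ m], which leaves a divided difference of [f]. *)
Lemma moment_pure (m J : nat) (f : {poly rat}) (d : seq int) :
  degree_sequence m d -> (forall i, (i <= m)%N -> 0 <= d`_i < J%:Z) ->
  (size f <= m)%N -> moment m J f (pure d) = 0.
Proof.
move=> dd dJ sf.
have dE i : (i <= m)%N -> (absz d`_i)%:Z = d`_i by move=> /dJ; lia.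
rewrite (@moment_col _ _ _ _ (fun i => absz d`_i)) => [|i /dJ|i j im]; last first.
- by rewrite dE // => /pure_eq0 ->; rewrite mulr0.
- by lia.
pose x i : rat := (d`_i)%:~R.
transitivity ((-1) ^+ m * \sum_(i < m.+1)
    f.[x i] * \prod_(k < m.+1 | k != i) (x i - x k)^-1); last first.
  rewrite sum_lagrange0 ?mulr0 //.
  by move=> i k im km /intr_inj; apply: (degree_sequence_inj dd).
rewrite mulr_sumr; apply: eq_bigr => i _.
have im : (i <= m)%N by rewrite -ltnS.
rewrite -[(absz _)%:R]/((absz _)%:Z%:~R) dE // (pure_sign dd im).
have -> : (-1) ^+ m = (-1) ^+ i * (-1) ^+ (m - i) :> rat.
  by rewrite -exprD subnKC.
by rewrite mulrACA.
Qed.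

Lemma moment_betti (m J : nat) (f : {poly rat}) (a : nat -> nat) :
  (degsum a m < J)%N ->
  moment m J f (betti m a) =
  \sum_(T : {set 'I_m}) (-1) ^+ #|T| * f.[(\sum_(t in T) a t.+1)%N%:R].
Proof.
move=> aJ.
pose F (T : {set 'I_m}) : diagram := fun i j =>
  ((#|T| == i) && ((\sum_(t in T) a t.+1)%N%:Z == j))%:R.
rewrite (@moment_ext _ _ _ _ (fun i j => \sum_(T : {set 'I_m}) F T i j));
  last by move=> i j; rewrite bettiE.
rewrite moment_sum; apply: eq_bigr => T _.
have Tm : (#|T| < m.+1)%N by rewrite ltnS -[leqRHS]card_ord max_card.
have TJ : (\sum_(t in T) a t.+1 < J)%N.
  apply: leq_ltn_trans aJ; rewrite /degsum big_add1 /= big_mkord.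
  by rewrite [leqRHS](bigID (mem T)) leq_addr.
rewrite /moment (bigD1 (Ordinal Tm)) //= [X in _ + X]big1 ?addr0 => [|i iT].
  rewrite (bigD1 (Ordinal TJ)) //= [X in _ + X]big1 ?addr0 => [|j jT].
    by rewrite /F !eqxx mulr1.
  rewrite /F (_ : _ == j%:Z = false) ?andbF ?mulr0 //.
  by apply: contraNF jT => /eqP [e]; apply/eqP/val_inj.
rewrite big1 // => j _; rewrite /F (_ : _ == _ :> nat = false) ?mulr0 //.
by apply: contraNF iT => /eqP e; apply/eqP/val_inj.
Qed.

(** * Chains of degree sequences *)

Lemma residualE (B : diagram) (l : decomposition) (n i : nat) (j : int) :
  (n <= size l)%N ->
  residual B l n i j =
  B i j - \sum_(1 <= s < n.+1) coef l s * pure (degs l s) i j.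
Proof.
move=> nl; rewrite /residual (big_nth (0, [::])) size_takel // big_add1 /=.
congr (_ - _); apply: eq_big_nat => k kn.
by rewrite nth_take //; lia.
Qed.

Lemma residualS (B : diagram) (l : decomposition) (s i : nat) (j : int) :
  (1 <= s <= size l)%N ->
  residual B l s i j =
  residual B l s.-1 i j - coef l s * pure (degs l s) i j.
Proof.
case: s => // s /= sl; rewrite !residualE ?(ltnW sl) //.
by rewrite big_nat_recr //= opprD addrA.
Qed.

Section Chain.
Variables (m N : nat) (B : diagram) (e : nat -> seq int) (Y : nat -> rat).
Variable p : nat -> position.

Hypothesis e_deg : forall s, (1 <= s <= N)%N -> degree_sequence m (e s).
Hypothesis Y_gt0 : forall s, (1 <= s <= N)%N -> 0 < Y s.
Hypothesis p_col : forall s, (1 <= s <= N)%N -> ((p s).1 <= m)%N.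
Hypothesis p_deg : forall s, (1 <= s <= N)%N -> (p s).2 = (e s)`_(p s).1.
Hypothesis e_const : forall s i, (1 <= s < N)%N -> (i <= m)%N ->
  i <> (p s).1 -> (e s.+1)`_i = (e s)`_i.
Hypothesis e_incr : forall s, (1 <= s < N)%N ->
  (e s)`_(p s).1 < (e s.+1)`_(p s).1.

Lemma chain_le (s t i : nat) :
  (1 <= s)%N -> (s <= t)%N -> (t <= N)%N -> (i <= m)%N -> (e s)`_i <= (e t)`_i.
Proof.
move=> s1 st tN im; elim: t st tN => [|t IH] st tN; first by lia.
move: st; rewrite leq_eqVlt => /orP[/eqP -> //|st].
apply: le_trans (IH st (ltnW tN)) _.
have [ip|/eqP ip] := eqVneq i (p t).1; first by rewrite ip ltW ?e_incr //; lia.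
by rewrite e_const //; lia.
Qed.

Lemma chain_lt (s t : nat) :
  (1 <= s)%N -> (s < t)%N -> (t <= N)%N -> (e s)`_(p s).1 < (e t)`_(p s).1.
Proof.
move=> s1 st tN; apply: lt_le_trans (e_incr _) _; first by lia.
by apply: chain_le => //; apply: p_col; lia.
Qed.

(** Follow column [i] upwards from step [t]: its entry stays the same until a step whose position
    lies in that column, or until the end of the chain. *)
Lemma chain_cover (t i : nat) :
  (1 <= t <= N)%N -> (i <= m)%N ->
  (exists2 s, (1 <= s < N)%N & p s = (i, (e t)`_i)) \/ (e t)`_i = (e N)`_i.
Proof.
move=> tN im; have [n] : exists n, (N - t = n)%N by exists (N - t)%N.
elim: n t tN => [|n IH] t tN tn; first by right; congr (_`_i); congr e; lia.
have [ip|/eqP ip] := eqVneq i (p t).1.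
  left; exists t; first by lia.
  by rewrite ip -p_deg //; case: (p t).
by rewrite -(@e_const t i) //; [apply: IH|]; lia.
Qed.

Hypothesis B_sum :
  forall i j, B i j = \sum_(1 <= s < N.+1) Y s * pure (e s) i j.

Let out : decomposition := mkseq (fun n => (Y n.+1, e n.+1)) N.

Lemma coef_chain (s : nat) : (1 <= s <= N)%N -> coef out s = Y s.
Proof. by case: s => // s sN; rewrite /coef nth_mkseq. Qed.

Lemma degs_chain (s : nat) : (1 <= s <= N)%N -> degs out s = e s.
Proof. by case: s => // s sN; rewrite /degs nth_mkseq. Qed.

Lemma residual_chain (n i : nat) (j : int) :
  (n <= N)%N ->
  residual B out n i j = \sum_(n.+1 <= s < N.+1) Y s * pure (e s) i j.
Proof.
move=> nN; rewrite residualE ?size_mkseq // B_sum.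
rewrite (@big_cat_nat _ _ _ n.+1) //= .
rewrite [X in _ - X](_ : _ = \sum_(1 <= s < n.+1) Y s * pure (e s) i j).
  by rewrite addrAC subrr add0r.
by apply: eq_big_nat => s sn; rewrite coef_chain ?degs_chain //; lia.
Qed.

Lemma residual_chain_ge0 (n i : nat) (j : int) :
  (n <= N)%N -> 0 <= residual B out n i j.
Proof.
move=> nN; rewrite residual_chain // big_nat_cond; apply: sumr_ge0 => s.
by rewrite andbT => sN; rewrite mulr_ge0 ?pure_ge0 // ltW // Y_gt0 //; lia.
Qed.

(** Past step [s] the column of [p s] has moved strictly up and never comes back, so no later term
    meets [p s]. *)
Lemma residual_chain_pos (s : nat) :
  (1 <= s <= N)%N ->
  entry (residual B out s.-1) (p s) = Y s * entry (pure (e s)) (p s).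
Proof.
move=> sN; rewrite /entry residual_chain; last by lia.
rewrite prednK; last by lia.
rewrite big_ltn; last by lia.
rewrite big_nat big1 ?addr0 // => t tN; rewrite pure_eq0 ?mulr0 //.
by rewrite p_deg // neq_lt chain_lt //; lia.
Qed.

Lemma entry_pure_gt0 (s : nat) :
  (1 <= s <= N)%N -> 0 < entry (pure (e s)) (p s).
Proof.
move=> sN; rewrite /entry p_deg //.
by apply: pure_gt0 (p_col sN); apply: e_deg.
Qed.

Lemma chain_coef_unique (s : nat) (y : rat) :
  (1 <= s <= N)%N ->
  entry (residual B out s.-1) (p s) - y * entry (pure (e s)) (p s) = 0 <->
  y = coef out s.
Proof.
move=> sN; rewrite residual_chain_pos // coef_chain // -mulrBl; split=> [/eqP|->].
  by rewrite mulf_eq0 subr_eq0 (gt_eqF (entry_pure_gt0 sN)) orbF => /eqP.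
by rewrite subrr mul0r.
Qed.

(** Positive coefficients exclude cancellation, so the least degrees left before step [s] are those
    of the lowest remaining sequence [e s]. *)
Lemma chain_bs : bs_decomposition m B out.
Proof.
rewrite /bs_decomposition size_mkseq; split; last first.
  by move=> i j; rewrite residual_chain // big_geq.
move=> s sN; rewrite degs_chain // coef_chain //; split; split.
- exact: e_deg.
- move=> i im; rewrite residual_chain; last by lia.
  rewrite prednK; last by lia.
  split.
    rewrite big_ltn; last by lia.
    rewrite gt_eqF // ltr_pwDl //.
      by rewrite mulr_gt0 ?Y_gt0 ?(pure_gt0 (e_deg sN)).
    rewrite big_nat_cond; apply: sumr_ge0 => t; rewrite andbT => tN.
    by rewrite mulr_ge0 ?pure_ge0 // ltW // Y_gt0 //; lia.
  move=> j; rewrite residual_chain; last by lia.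
  rewrite prednK; last by lia.
  apply: contraNT; rewrite -ltNge => jlt; rewrite big_nat big1 // => t tN.
  rewrite pure_eq0 ?mulr0 // neq_lt (lt_le_trans jlt) // chain_le //; lia.
- exact: Y_gt0.
- move=> i j; rewrite -coef_chain // -degs_chain // -residualS ?size_mkseq //.
  by apply: residual_chain_ge0; lia.
(* Only [e s] contributes at [p s], so nonnegativity of this one entry bounds [q'] by [Y s]. *)
move=> q' /(_ (p s).1 (p s).2).
rewrite -/(entry (residual _ _ _) _) -/(entry (pure _) _) residual_chain_pos //.
by rewrite -mulrBl pmulr_lge0 ?entry_pure_gt0 // subr_ge0.
Qed.

End Chain.

(** * Without mass elimination the chain changes one column per step *)

Section NoMassElimination.
Variables (c : nat) (B : diagram) (l : decomposition) (pos : nat -> position).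
Hypothesis l_bs : bs_decomposition c B l.
Hypothesis no_mass : ~ mass_elimination B l.
Hypothesis pos_l : forall s, (1 <= s < size l)%N -> eliminated B l s (pos s).

Lemma bs_sum (i : nat) (j : int) :
  B i j = \sum_(1 <= s < (size l).+1) coef l s * pure (degs l s) i j.
Proof.
by apply/eqP; rewrite -subr_eq0 -residualE //; apply/eqP; case: l_bs.
Qed.

Lemma bs_degree_sequence (s : nat) :
  (1 <= s <= size l)%N -> degree_sequence c (degs l s).
Proof. by move=> /(l_bs.1) [[]]. Qed.

Lemma bs_coef_gt0 (s : nat) : (1 <= s <= size l)%N -> 0 < coef l s.
Proof. by move=> /(l_bs.1) [_ []]. Qed.

Lemma bs_residual_ge0 (s i : nat) (j : int) :
  (1 <= s <= size l)%N -> 0 <= residual B l s i j.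
Proof.
by move=> sl; rewrite residualS //; have [_ []] := l_bs.1 s sl.
Qed.

Lemma bs_residual_le (s t i : nat) (j : int) :
  (t <= s)%N -> (s <= size l)%N -> residual B l s i j <= residual B l t i j.
Proof.
elim: s => [|s IH] ts sl; first by move: ts; rewrite leqn0 => /eqP ->.
move: ts; rewrite leq_eqVlt => /orP[/eqP -> //|ts].
apply: le_trans (IH ts (ltnW sl)); rewrite residualS //= gerBl.
by rewrite mulr_ge0 ?pure_ge0 // ltW // bs_coef_gt0.
Qed.

(** An entry that first vanishes at step [s] was altered by it, hence lies on the support of the
    pure diagram subtracted there. *)
Lemma eliminated_pos (s : nat) :
  (1 <= s < size l)%N ->
  ((pos s).1 <= c)%N /\ (pos s).2 = (degs l s)`_(pos s).1.
Proof.
move=> sl; have sl' : (1 <= s <= size l)%N by lia.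
have [ps0 /(_ s.-1)] := pos_l sl; move/(_ ltac:(lia))/eqP.
move: ps0; rewrite /entry residualS //.
have [[sd _] _] := (l_bs.1 s sl').1.
rewrite /pure sd ltnS; case: (leqP _ c) => [_|_] /=; last first.
  by rewrite mulr0 subr0 => ->; rewrite eqxx.
by case: eqP => // _; rewrite mulr0 subr0 => ->; rewrite eqxx.
Qed.

(** Residuals decrease and stay nonnegative, so an entry nonzero after step [s] was nonzero before
    it and bounds the earlier minimum. *)
Lemma degs_step_le (s i : nat) :
  (1 <= s < size l)%N -> (i <= c)%N -> (degs l s)`_i <= (degs l s.+1)`_i.
Proof.
move=> sl ic.
have [[_ d0] _] := l_bs.1 s ltac:(lia).
have [[_ d1] _] := l_bs.1 s.+1 ltac:(lia).
apply: (d0 i ic).2; apply: lt0r_neq0.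
apply: lt_le_trans (bs_residual_le _ _ (leq_pred s) ltac:(lia)).
by rewrite lt0r (d1 i ic).1 bs_residual_ge0 //; lia.
Qed.

(* Residuals decrease, so a second entry vanishing at step [s] would be nonzero
   before that step, hence eliminated by it. *)
Lemma degs_const (s i : nat) :
  (1 <= s < size l)%N -> (i <= c)%N -> i <> (pos s).1 ->
  (degs l s.+1)`_i = (degs l s)`_i.
Proof.
move=> sl ic ip; apply/eqP; rewrite eq_le degs_step_le // andbT.
have [[_ d0] _] := l_bs.1 s ltac:(lia).
have [[_ d1] _] := l_bs.1 s.+1 ltac:(lia).
apply: (d1 i ic).2; apply/eqP => r0; apply: no_mass; exists s => //.
exists (pos s), (i, (degs l s)`_i); split; [|exact: pos_l|].
  by move=> e; apply: ip; rewrite e.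
split=> // t ts; apply/eqP/lt0r_neq0; rewrite /entry /=.
apply: lt_le_trans (bs_residual_le _ _ (_ : (t <= s.-1)%N) _); [|lia|lia].
rewrite lt0r (d0 i ic).1 /=.
by apply: le_trans (bs_residual_ge0 _ _ (_ : 1 <= s <= _)%N)
  (bs_residual_le _ _ (leq_pred s) _); lia.
Qed.

(** If the column did not move, the next minimal degree sequence would pass through the entry just
    eliminated. *)
Lemma degs_incr (s : nat) :
  (1 <= s < size l)%N -> (degs l s)`_(pos s).1 < (degs l s.+1)`_(pos s).1.
Proof.
move=> sl; have [pc p2] := eliminated_pos sl.
rewrite lt_neqAle degs_step_le // andbT; apply/eqP => e.
have [_ /(_ _ pc) [+ _]] := (l_bs.1 s.+1 ltac:(lia)).1.
rewrite -e -p2 => /eqP; apply; exact: (pos_l sl).1.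
Qed.

End NoMassElimination.

(** * The decomposition of [betti c.+1 a] *)

Section NewDecomposition.
Variables (c : nat) (a : nat -> nat) (l : decomposition).
Variables (pos : nat -> position) (r : nat -> rat).
Hypothesis c_gt1 : (1 < c)%N.
Hypothesis a_gt0 : forall t, (1 <= t <= c.+1)%N -> (0 < a t)%N.
Hypothesis a_le : forall t, (1 <= t <= c)%N -> (a t <= a t.+1)%N.
Hypothesis l_bs : bs_decomposition c (betti c a) l.
Hypothesis no_mass : ~ mass_elimination (betti c a) l.
Hypothesis pos_l : elimination_positions c a l pos.
Hypothesis r_l : remainders c a l pos r.
Hypothesis a_sum : (degsum a c < a c.+1)%N.

Let eps := size l.
Let A := degsum a c.
Let al := a c.+1.
Let D := degsum a c.+1.
(* [top i] is the largest degree in column [i] of [betti c a], and [upper i] the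
   smallest degree in column [i.+1] of the copy of [betti c a] shifted by [al]. *)
Let top (i : nat) : nat := (A - degsum a (c - i))%N.
Let upper (i : nat) : nat := (al + degsum a i)%N.

Lemma degsum_lt (i k : nat) :
  (i < k)%N -> (k <= c.+1)%N -> (degsum a i < degsum a k)%N.
Proof.
move=> ik kc; apply: leq_trans (degsum_le a ik).
by rewrite degsumS; have := a_gt0 (t := i.+1); lia.
Qed.

Lemma D_E : D = (A + al)%N.
Proof. exact: degsumS. Qed.

Lemma top_lt (i k : nat) : (i < k)%N -> (k <= c)%N -> (top i < top k)%N.
Proof.
move=> ik kc; rewrite /top.
have := @degsum_lt (c - k) (c - i); have := degsum_le a (leq_subr i c).
by rewrite -/A; lia.
Qed.

Lemma top_le (i : nat) : (top i <= A)%N. Proof. exact: leq_subr. Qed.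

Lemma topc : top c = A.
Proof. by rewrite /top subnn /degsum big_geq ?subn0. Qed.

Lemma top0 : top 0 = 0%N.
Proof. by rewrite /top subn0 subnn. Qed.

Lemma upperc : upper c = D.
Proof. by rewrite /upper D_E addnC. Qed.

Lemma upper_lt (i k : nat) : (i < k)%N -> (k <= c)%N -> (upper i < upper k)%N.
Proof. by move=> ik kc; rewrite /upper ltn_add2l degsum_lt // ltnW. Qed.

Lemma top_lt_upper (i k : nat) : (top i < upper k)%N.
Proof.
by rewrite /upper; have := top_le i; have := a_sum; rewrite -/A -/al; lia.
Qed.

(** * The chain of degree sequences of [betti c a] *)

Lemma size_l_gt0 : (0 < eps)%N.
Proof.
rewrite lt0n; apply/eqP => e0; have := betti_max a (leq0n c).
by rewrite (bs_sum l_bs) -/eps e0 big_geq // eqxx.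
Qed.

Lemma degs_support (s i : nat) :
  (1 <= s <= eps)%N -> (i <= c)%N -> betti c a i (degs l s)`_i != 0.
Proof.
move=> sl ic; rewrite (bs_sum l_bs); apply: lt0r_neq0.
rewrite (bigD1_seq s) ?mem_index_iota ?iota_uniq //=.
rewrite ltr_pwDl //.
  rewrite mulr_gt0 ?(bs_coef_gt0 l_bs) //.
  exact: pure_gt0 (bs_degree_sequence l_bs sl) ic.
rewrite big_seq_cond; apply: sumr_ge0 => t /andP[]; rewrite mem_index_iota => tl _.
by rewrite mulr_ge0 ?pure_ge0 // ltW // (bs_coef_gt0 l_bs).
Qed.

Lemma degs_range (s i : nat) :
  (1 <= s <= eps)%N -> (i <= c)%N -> 0 <= (degs l s)`_i <= (top i)%:Z.
Proof.
move=> sl ic; have [] := betti_neq0 _ (degs_support sl ic).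
  by move=> t tc; apply: a_le; lia.
by rewrite /top -/A => _ -> /=; have := degsum_le a (leq_subr i c); rewrite -/A; lia.
Qed.

Lemma degs_const_l (s i : nat) :
  (1 <= s < eps)%N -> (i <= c)%N -> i <> (pos s).1 ->
  (degs l s.+1)`_i = (degs l s)`_i.
Proof. by move=> sl ic ip; apply: (degs_const l_bs no_mass pos_l.1). Qed.

Lemma degs_incr_l (s : nat) :
  (1 <= s < eps)%N -> (degs l s)`_(pos s).1 < (degs l s.+1)`_(pos s).1.
Proof. by move=> sl; apply: (degs_incr l_bs pos_l.1). Qed.

Lemma betti_degs (i : nat) (j : int) :
  betti c a i j != 0 -> exists2 s, (1 <= s <= eps)%N & j = (degs l s)`_i.
Proof.
move=> Bij; have [/existsP[s /andP[s1 /eqP]]|/existsPn none] :=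
  boolP [exists s : 'I_eps.+1, (0 < s)%N && (j == (degs l s)`_i)].
  by exists s => //; rewrite s1 -ltnS /=.
case/eqP: Bij; rewrite (bs_sum l_bs) big_nat big1 // => s sl.
have se : (s < eps.+1)%N by lia.
rewrite pure_eq0 ?mulr0 //.
by have := none (Ordinal se); rewrite /= (_ : 0 < s)%N //; lia.
Qed.

(** The entry of highest degree in column [i] is nonzero, so some sequence of the chain reaches it.
    Columns only move up and none exceeds [top]. *)
Lemma degs_last (i : nat) : (i <= c)%N -> (degs l eps)`_i = (top i)%:Z.
Proof.
move=> ic; have e1 := size_l_gt0.
have /andP[_ le_top] := @degs_range eps i ltac:(lia) ic.
apply/eqP; rewrite eq_le le_top /=.
have top_eq : (top i)%:Z = A%:Z - (degsum a (c - i))%:Z.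
  by rewrite /top; have := degsum_le a (leq_subr i c); rewrite -/A; lia.
have := betti_max a ic; rewrite -/A -top_eq => /betti_degs[s sl ->].
apply: (chain_le (N := eps) (m := c) (p := pos)) => //; try lia.
- exact: degs_const_l.
- exact: degs_incr_l.
Qed.

Lemma pos_col (s : nat) : (1 <= s <= eps)%N -> ((pos s).1 <= c)%N.
Proof.
move=> sl; have [->|se] := eqVneq s eps; first by rewrite pos_l.2.
by have [] := eliminated_pos l_bs pos_l.1 (s := s) ltac:(rewrite -/eps; lia).
Qed.

(** The conventional last position [(c, A)] fits the pattern too, because the last sequence ends at
    [top c = A]. *)
Lemma pos_deg (s : nat) :
  (1 <= s <= eps)%N -> (pos s).2 = (degs l s)`_(pos s).1.
Proof.
move=> sl; have [->|se] := eqVneq s eps; first by rewrite pos_l.2 /= degs_last // topc.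
by have [] := eliminated_pos l_bs pos_l.1 (s := s) ltac:(rewrite -/eps; lia).
Qed.

Lemma degs_lt_l (s t : nat) :
  (1 <= s)%N -> (s < t)%N -> (t <= eps)%N ->
  (degs l s)`_(pos s).1 < (degs l t)`_(pos s).1.
Proof.
apply: (chain_lt (m := c)); [exact: pos_col|exact: degs_const_l|exact: degs_incr_l].
Qed.

(** The system of equations at the eliminated positions is triangular: later pure diagrams vanish
    there. *)
Lemma entry_pos_sum (z : nat -> rat) (s : nat) :
  (1 <= s <= eps)%N ->
  \sum_(1 <= t < eps.+1) z t * entry (pure (degs l t)) (pos s) =
  \sum_(1 <= t < s) z t * entry (pure (degs l t)) (pos s) +
  z s * entry (pure (degs l s)) (pos s).
Proof.
move=> sl; rewrite (@big_cat_nat _ _ _ s.+1) //=; [|lia].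
rewrite [X in _ + X = _]big_nat [X in _ + X = _]big1 ?addr0 => [|t tl].
  by rewrite big_nat_recr //=; lia.
rewrite /entry pure_eq0 ?mulr0 // pos_deg // neq_lt degs_lt_l //; lia.
Qed.

(* [G i j / (D - j)] is what Phase 1 leaves at [(i, j)] when [j < al]. *)
Let G : diagram := fun i j =>
  (A%:Z - j)%:~R * betti c a i j +
  \sum_(1 <= s < eps.+1) r s * pure (degs l s) i j.

(* The recursion defining the remainders solves these equations. *)
Lemma G_pos (s : nat) : (1 <= s <= eps)%N -> G (pos s).1 (pos s).2 = 0.
Proof.
move=> sl; rewrite /G.
rewrite (eq_bigr (fun t => r t * entry (pure (degs l t)) (pos s))) //.
rewrite entry_pos_sum //.
have ps0 : entry (pure (degs l s)) (pos s) != 0.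
  rewrite /entry pos_deg //; apply/lt0r_neq0.
  by apply: (pure_gt0 (bs_degree_sequence l_bs sl)); apply: pos_col.
have := r_l; rewrite /remainders => -[r1 rk].
have [s1|s1] := eqVneq s 1%N.
  rewrite s1 in sl ps0 *; rewrite r1 big_geq // add0r.
  have -> : betti c a (pos 1%N).1 (pos 1%N).2 =
            coef l 1 * entry (pure (degs l 1)) (pos 1%N).
    rewrite (bs_sum l_bs) -/eps.
    have := entry_pos_sum (coef l) sl; rewrite [X in X + _]big_geq // add0r => <-.
    by [].
  by rewrite -/A !intrB; ring.
rewrite (rk s); last by rewrite -/eps; lia.
rewrite -/A mulrBl mulr_suml.
rewrite [X in _ + (_ + (_ - X))](eq_bigr
  (fun t => r t * entry (pure (degs l t)) (pos s))) => [|t _]; last first.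
  by rewrite mulrAC divfK // mulrC.
rewrite [X in _ + X]addrC subrK mulrAC divfK // /entry -mulrDl -intrD.
by rewrite addrC subrKA subrr mul0r.
Qed.

(** Every degree in the support is either eliminated before the last step, where [G_pos] applies, or
    the top of its column. The top of column [c] is the last position, again covered by [G_pos]. *)
Lemma G_eq0 (i : nat) (j : int) :
  (i <= c)%N -> ~~ ((i < c)%N && (j == (top i)%:Z)) -> G i j = 0.
Proof.
move=> ic nij.
have [/existsP[t /andP[t1 /eqP jt]]|/existsPn none] :=
  boolP [exists t : 'I_eps.+1, (0 < t)%N && (j == (degs l t)`_i)].
  have tl : (1 <= t <= eps)%N by rewrite t1 -ltnS /=.
  have [[s sl ps]|e] := chain_cover pos_deg degs_const_l tl ic.
    have := @G_pos s ltac:(lia).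
    by rewrite ps /= jt.
  move: nij; rewrite jt e degs_last // eqxx andbT -leqNgt => ci.
  have {ci} -> : i = c by lia.
  have := @G_pos eps; rewrite pos_l.2 /= topc; apply.
  by have := size_l_gt0; lia.
have -> : G i j = (A%:Z - j)%:~R * betti c a i j.
  rewrite /G big_nat big1 ?addr0 // => t tl.
  have te : (t < eps.+1)%N by lia.
  rewrite pure_eq0 ?mulr0 //.
  by have := none (Ordinal te); rewrite /= (_ : 0 < t)%N //; lia.
case: (eqVneq (betti c a i j) 0) => [->|/betti_degs[t tl jt]].
  by rewrite mulr0.
have te : (t < eps.+1)%N by lia.
by have := none (Ordinal te); rewrite /= jt eqxx andbT; lia.
Qed.

(** * The remainder of Phase 1 as a multiple of a pure diagram *)

Let tops : seq int := mkseq (fun k => (top k)%:Z) c.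

Lemma degree_sequence_tops : degree_sequence c.-1 tops.
Proof.
split; first by rewrite size_mkseq; lia.
apply/(sortedP 0) => i; rewrite size_mkseq => ic.
by rewrite !nth_mkseq ?ltz_nat ?top_lt //; lia.
Qed.

(** This is [c!] times the multiplicity of the complete intersection, the constant produced by
    [sum_sign_horner]. *)
Let C : rat := (c`! * \prod_(t < c) a t.+1)%N%:R.

Lemma C_gt0 : 0 < C.
Proof.
rewrite ltr0n muln_gt0 fact_gt0 /=; apply: prodn_gt0 => t.
by apply: a_gt0; have := ltn_ord t; lia.
Qed.

(* The test polynomial is the numerator of the Lagrange polynomial of [top i]
   on the nodes [top 0, ..., top c.-1]: it isolates one entry of [G]. *)
Lemma G_top (i : nat) :
  (i < c)%N -> G i (top i)%:Z = C * pure tops i (top i)%:Z.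
Proof.
move=> ic; have ci : (i <= c.-1)%N by lia.
have cE : c.-1.+1 = c by lia.
pose x k : rat := (top k)%:R.
have xI i' k : (i' <= c)%N -> (k <= c)%N -> x i' = x k -> i' = k.
  move=> i'c kc /eqP; rewrite eqr_nat => /eqP e.
  by case: (ltngtP i' k) => // [/top_lt/(_ kc)|/top_lt/(_ i'c)]; rewrite e ltnn.
pose i0 : 'I_c.-1.+1 := Ordinal (ci : (i < c.-1.+1)%N).
pose f := \prod_(k < c.-1.+1 | k != i0) ('X - (x k)%:P).
have [fm sf] : f \is monic /\ size f = c.-1.+1 by apply: prod_XsubC_neq.
have fE y : f.[y] = \prod_(k < c.-1.+1 | k != i :> nat) (y - x k).
  by rewrite horner_prod; apply: eq_bigr => k _; rewrite hornerXsubC.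
have f_top k : (k < c)%N -> k != i -> f.[x k] = 0.
  move=> kc ki; have kc' : (k < c.-1.+1)%N by lia.
  by rewrite fE (bigD1 (Ordinal kc')) //= subrr mul0r.
have mG : moment c A.+1 f G = (-1) ^+ i * f.[x i] * G i (top i)%:Z.
  rewrite (@moment_col _ _ _ _ top) => [|k kc|k j kc jk]; last first.
  - by rewrite (@G_eq0 k j) ?mulr0 // negb_and jk orbT.
  - by rewrite ltnS top_le.
  have ic' : (i < c.+1)%N by lia.
  rewrite (bigD1 (Ordinal ic')) //= [X in _ + X]big1 ?addr0 // => k ki.
  have [kc|kc] := ltnP k c; first by rewrite f_top // mulr0 mul0r.
  by rewrite G_eq0 ?mulr0 ?ltnNge ?kc // -ltnS.
(* The pure terms of [G] have zero moment because [f] has degree [c.-1]. The factor [A - j] of the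
   other term raises the test polynomial to degree [c] with leading coefficient -1, whence the
   exponent [c.-1]. *)
have mB : moment c A.+1 f G = (-1) ^+ c.-1 * C.
  pose q : {poly rat} := A%:R%:P - 'X.
  rewrite momentD.
  rewrite (moment_sum _ _ _ _ _ (fun s i j => r s * pure (degs l s) i j)).
  rewrite [X in _ + X]big_nat [X in _ + X]big1 ?addr0 => [|s sl]; last first.
    rewrite momentZ moment_pure ?mulr0 ?sf ?cE //.
      exact: (bs_degree_sequence l_bs sl).
    move=> k kc; have /andP[-> /=] := @degs_range s k sl kc.
    by have := top_le k; lia.
  transitivity (moment c A.+1 (f * q) (betti c a)).
    apply: eq_bigr => k _; apply: eq_bigr => j _.
    by rewrite hornerM hornerD hornerN hornerC hornerX intrB !mulrA.
  rewrite moment_betti // sum_sign_horner; last first.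
    rewrite -[q]opprB mulrN size_polyN; apply: leq_trans (size_polyMleq _ _) _.
    by rewrite sf size_XsubC; lia.
  rewrite /q mulrBr coefB coefMC coefMX (_ : c == 0%N = false); last by lia.
  move/monicP: fm; rewrite /lead_coef sf /= => ->.
  rewrite (leq_sizeP _ _ _ c (leqnn c)); last by rewrite sf; lia.
  rewrite mul0r sub0r -/C -{1}cE exprS; ring.
have fi0 : f.[x i] != 0.
  rewrite fE; apply/prodf_neq0 => k ki; rewrite subr_eq0.
  by apply: contra ki => /eqP /xI -> //; have := ltn_ord k; lia.
have ti : (top i)%:Z = tops`_i by rewrite nth_mkseq.
rewrite [in RHS]ti (pure_sign degree_sequence_tops ci) -ti.
have -> : \prod_(k < c.-1.+1 | k != i :> nat) ((top i)%:~R - (tops`_k)%:~R)^-1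
          = (f.[x i])^-1 :> rat.
  rewrite fE -prodfV; apply: eq_bigr => k _.
  by rewrite nth_mkseq //; have := ltn_ord k; lia.
have s0 : (-1) ^+ i * f.[x i] != 0 by rewrite mulf_neq0 // signr_eq0.
apply: (mulfI s0); rewrite -mG mB.
have -> : (-1) ^+ c.-1 = (-1) ^+ i * (-1) ^+ (c.-1 - i) :> rat.
  by rewrite -exprD subnKC.
move: fi0; move: f.[x i] ((-1) ^+ i) ((-1) ^+ (c.-1 - i)%N) C => y s t z y0.
by field.
Qed.

(* [mid j] is e^(eps + c - j), for [0 <= j <= c]. *)
Let mid (j : nat) : seq int :=
  mkseq (fun i => if (i <= j)%N then (top i)%:Z else (upper i.-1)%:Z) c.+2.

Lemma degree_sequence_mid (j : nat) :
  (j <= c)%N -> degree_sequence c.+1 (mid j).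
Proof.
move=> jc; split; first by rewrite size_mkseq.
apply/(sortedP 0) => i; rewrite size_mkseq => ic.
rewrite !nth_mkseq //; last exact: ltnW.
case: (ltngtP i j) => ij; rewrite ltz_nat.
- by apply: top_lt => //; lia.
- by case: i ij ic => // i ij ic; apply: upper_lt; lia.
- exact: top_lt_upper.
Qed.

Lemma nth_mid (j i : nat) : (i <= c.+1)%N ->
  (mid j)`_i = if (i <= j)%N then (top i)%:Z else (upper i.-1)%:Z.
Proof. by move=> ic; rewrite nth_mkseq. Qed.

(** Reflection exchanges the two kinds of entries: [D - top i = upper (c - i)]. *)
Lemma dual_mid (j : nat) : (j <= c)%N -> dual (mid j) = mid (c - j).
Proof.
move=> jc; have sm k : size (mid k) = c.+2 by rewrite size_mkseq.
apply: (@eq_from_nth _ 0) => [|i]; rewrite size_dual !sm // => ic.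
rewrite (nth_dual (sm j)) // !nth_mid ?leq_subr //.
rewrite (_ : (c.+1 <= j)%N = false) /=; last by lia.
rewrite upperc D_E.
have dA : A = degsum a c by [].
have [ij|ij] := leqP i (c - j).
  rewrite (_ : (c.+1 - i <= j)%N = false); last by lia.
  have := degsum_le a (leq_subr i c); rewrite /upper /top -dA.
  by rewrite (_ : (c.+1 - i).-1 = c - i)%N; lia.
rewrite (_ : (c.+1 - i <= j)%N); last by lia.
have := @degsum_le a i.-1 c; rewrite /upper /top -dA.
by rewrite (_ : c - (c.+1 - i) = i.-1)%N; lia.
Qed.

(** * The coefficients of Phase 2 *)

Let w (j : nat) : rat := C * ((upper j)%:R - (top j)%:R).

Lemma w_gt0 (j : nat) : 0 < w j.
Proof. by rewrite mulr_gt0 ?C_gt0 // subr_gt0 ltr_nat top_lt_upper. Qed.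

Lemma w_dual (j : nat) : (j <= c)%N -> w (c - j) = w j.
Proof.
move=> jc; rewrite /w -!natrB ?(ltnW (top_lt_upper _ _)) //; congr (_ * _%:R).
have := degsum_le a (leq_subr j c); have := @degsum_le a j c jc.
by rewrite /upper /top subKn // -/A; lia.
Qed.

(** Multiplied by [C], the right side is [G / (D - j)] at the top of column [i], so Phase 2 supplies
    exactly what Phase 1 leaves there. The sum starts at [i] because column [i] of [mid j] is
    [top i] only for [i <= j]. *)
Lemma sum_pure_mid (i : nat) :
  (i < c)%N ->
  \sum_(i <= j < c) ((upper j)%:R - (top j)%:R) * pure (mid j) i (top i)%:Z =
  pure tops i (top i)%:Z / (D%:Z - (top i)%:Z)%:~R.
Proof.
move=> ic.
pose P n : rat :=
  \prod_(0 <= k < n | k != i) (`|(top i)%:Z - (top k)%:Z|%:Q)^-1.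
pose Q n : rat := \prod_(n <= k < c.+1) ((upper k)%:R - (top i)%:R)^-1.
(* The sum telescopes: for [j > i] its term is [P j.+1 * Q j.+1 - P j * Q j]. *)
have PS n : n != i -> P n.+1 = P n * (`|(top i)%:Z - (top n)%:Z|%:Q)^-1.
  by move=> ni; rewrite /P big_mkcond big_nat_recr //= -big_mkcond ni.
have Pi : P i.+1 = P i.
  by rewrite /P big_mkcond big_nat_recr //= -big_mkcond eqxx mulr1.
have QS n : (n <= c)%N -> Q n = ((upper n)%:R - (top i)%:R)^-1 * Q n.+1.
  by move=> nc; rewrite /Q big_ltn.
have pure_mid j : (i <= j)%N -> (j < c)%N ->
    pure (mid j) i (top i)%:Z = P j.+1 * Q j.
  move=> ij jc; have ic' : (i <= c.+1)%N by lia.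
  have := size_mkseq _ _ : size (mid j) = c.+2; have := nth_mid j.
  move: (mid j) => d d_nth sd; rewrite /pure sd (d_nth i ic') ij eqxx andbT.
  rewrite (_ : i < c.+2)%N /=; last by lia.
  rewrite -(big_mkord (fun k => k != i) (fun k => (`|(top i)%:Z - d`_k|%:Q)^-1)).
  rewrite (@big_cat_nat _ _ _ j.+1) //=; last by lia.
  congr (_ * _).
    rewrite /P big_nat_cond [RHS]big_nat_cond; apply: eq_bigr => k /andP[kj _].
    have kc : (k <= c.+1)%N by lia.
    by rewrite (d_nth _ kc) (_ : k <= j)%N //; lia.
  rewrite big_add1 /= /Q big_nat_cond [RHS]big_nat_cond.
  apply: eq_big => [k|k /andP[kj _]]; first by lia.
  have kc : (k.+1 <= c.+1)%N by lia.
  rewrite (d_nth _ kc) (_ : (k.+1 <= j)%N = false) /=; last by lia.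
  have := ltnW (top_lt_upper i k) => tu.
  by rewrite distrC ger0_norm ?subr_ge0 ?lez_nat // intrB.
have u0 k : (upper k)%:R - (top i)%:R != 0 :> rat.
  by rewrite subr_eq0 eqr_nat; have := top_lt_upper i k; lia.
have sumE n : (i < n)%N -> (n <= c)%N ->
    \sum_(i <= j < n) ((upper j)%:R - (top j)%:R) * pure (mid j) i (top i)%:Z =
    P n * Q n.
  elim: n => // n IH i_n nc; rewrite big_nat_recr //=.
  rewrite pure_mid // QS; last by lia.
  (* Start of the telescoping: [P i.+1 = P i], and the gap [upper i - top i] cancels the first
     factor of [Q i]. *)
  have [->|ni] := eqVneq n i.
    by rewrite big_geq // add0r mulrCA mulVKf.
  have i_lt_n : (i < n)%N by lia.
  rewrite IH //; last by lia.
  rewrite (QS n) ?(PS n) //; last by lia.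
  have tt := top_lt i_lt_n (ltnW nc).
  rewrite ltr0_norm ?subr_lt0 ?ltz_nat // intrN intrB opprB.
  have : (top n)%:R - (top i)%:R != 0 :> rat by rewrite subr_eq0 eqr_nat; lia.
  have := u0 n; rewrite -![(top _)%:~R]/((top _)%:R).
  move: (P n) (Q n.+1) (upper n)%:R (top n)%:R (top i)%:R => p q u t t' ut tt'.
  by field; rewrite ut tt'.
rewrite sumE // QS // /Q big_geq // mulr1 upperc intrB; congr (_ / _).
rewrite /pure size_mkseq ic nth_mkseq // eqxx /= /P big_mkord.
by apply: eq_bigr => k _; rewrite nth_mkseq.
Qed.

(** * The candidate decomposition and its sum *)

Let y (s : nat) : rat := al%:R * coef l s - r s.
Let long (s : nat) : seq int := phase1_degs c a l s.

Lemma size_degs (s : nat) : (1 <= s <= eps)%N -> size (degs l s) = c.+1.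
Proof. by move=> sl; case: (bs_degree_sequence l_bs sl). Qed.

Lemma size_long (s : nat) : (1 <= s <= eps)%N -> size (long s) = c.+2.
Proof. by move=> sl; rewrite size_rcons size_degs. Qed.

Lemma nth_long (s i : nat) :
  (1 <= s <= eps)%N -> (i <= c.+1)%N ->
  (long s)`_i = if (i <= c)%N then (degs l s)`_i else D%:Z.
Proof.
move=> sl ic; rewrite nth_rcons size_degs // ltnS; case: leqP => // ci.
by rewrite (_ : i == c.+1) //; lia.
Qed.

Lemma degs_ltD (s i : nat) :
  (1 <= s <= eps)%N -> (i <= c)%N -> (degs l s)`_i < D%:Z.
Proof.
move=> sl ic; have /andP[_ le_top] := degs_range sl ic.
by apply: le_lt_trans le_top _; rewrite ltz_nat -upperc top_lt_upper.
Qed.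

Lemma degree_sequence_long (s : nat) :
  (1 <= s <= eps)%N -> degree_sequence c.+1 (long s).
Proof.
move=> sl; split; first exact: size_long.
apply/(sortedP 0) => i; rewrite size_long // ltnS => ic.
rewrite !nth_long //; last exact: ltnW.
rewrite (_ : i <= c)%N; last by lia.
case: (leqP i.+1 c) => ic'; last by apply: degs_ltD => //; lia.
by apply: (degree_sequence_lt (bs_degree_sequence l_bs sl)).
Qed.

Lemma long_range (s i : nat) :
  (1 <= s <= eps)%N -> (i <= c.+1)%N -> 0 <= (long s)`_i <= D%:Z.
Proof.
move=> sl ic; rewrite nth_long //; case: leqP => ic'; last by rewrite lexx andbT.
by have /andP[-> _] := degs_range sl ic'; rewrite ltW // degs_ltD.
Qed.

Lemma nth_dual_long (s i : nat) :
  (1 <= s <= eps)%N -> (i <= c.+1)%N ->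
  (dual (long s))`_i = D%:Z - (long s)`_(c.+1 - i).
Proof.
move=> sl ic; rewrite (nth_dual (size_long sl)) // (nth_long sl (leqnn _)).
by rewrite ltnn.
Qed.

Lemma pure_long (s i : nat) (j : int) :
  (1 <= s <= eps)%N -> (i <= c)%N ->
  pure (long s) i j = pure (degs l s) i j / (D%:Z - j)%:~R.
Proof.
move=> sl ic; rewrite pure_rcons ?size_degs // => k; rewrite ltnS.
exact: degs_ltD.
Qed.

(** The three sums are the three phases. The ends [mid c] and [mid 0] are absent from the middle
    sum, being the last sequence of Phase 1 and its dual. *)
Let T : diagram := fun i j =>
  \sum_(1 <= s < eps.+1) y s * pure (long s) i j +
  \sum_(1 <= k < c) w k * pure (mid k) i j +
  \sum_(1 <= s < eps.+1) y s * pure (dual (long s)) i j.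

(** In these degrees neither the shifted copy of [betti c a] nor Phase 3 contributes. Phase 1 gives
    [betti c a] minus [G / (D - j)], and Phase 2 restores the difference. Column 0 is left out
    because Phase 3 also meets [(0, 0)]. *)
Lemma T_low (i : nat) (j : int) :
  (1 <= i <= c)%N -> j < al%:Z -> T i j = betti c.+1 a i j.
Proof.
move=> ic jal; have DA : D%:Z = A%:Z + al%:Z by rewrite D_E.
have Dj : (D%:Z - j)%:~R != 0 :> rat.
  by rewrite intr_eq0; apply/eqP => e; lia.
have -> : betti c.+1 a i j = betti c a i j.
  rewrite bettiS; case: i ic => [|i] ic; first by rewrite addr0.
  case: (eqVneq (betti c a i (j - (a c.+1)%:Z)) 0) => [->|]; first by rewrite addr0.
  move=> /(betti_neq0 _) [|_ jge0 _]; last by move: jal jge0; rewrite /al; lia.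
  by move=> t tc; apply: a_le; lia.
(* A Phase 3 entry in these columns is [D] minus a degree at most [A], hence at least [al]. *)
rewrite /T [X in _ + X]big_nat [X in _ + X]big1 ?addr0 => [|s sl]; last first.
  rewrite pure_eq0 ?mulr0 // nth_dual_long //; last by lia.
  rewrite nth_long //; last by lia.
  rewrite (_ : c.+1 - i <= c)%N; last by lia.
  have ci : (c.+1 - i <= c)%N by lia.
  have /andP[_ le_top] := @degs_range s _ sl ci.
  by have := top_le (c.+1 - i); apply: contraTneq => ej; lia.
have -> : \sum_(1 <= s < eps.+1) y s * pure (long s) i j =
          betti c a i j - G i j / (D%:Z - j)%:~R.
  apply: (mulIf Dj); rewrite mulrBl divfK // mulr_suml.
  rewrite (eq_big_nat _ _ (F2 := fun s => al%:R * (coef l s * pure (degs l s) i j)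
      - r s * pure (degs l s) i j)) => [|s sl]; last first.
    rewrite pure_long //; last by lia.
    by rewrite mulrA divfK // /y mulrBl mulrA.
  rewrite sumrB -mulr_sumr -(bs_sum l_bs) /G DA !intrB !intrD; ring.
suff -> : \sum_(1 <= k < c) w k * pure (mid k) i j = G i j / (D%:Z - j)%:~R.
  by rewrite subrK.
have mid0 k : (1 <= k < c)%N -> ~~ ((i <= k)%N && (j == (top i)%:Z)) ->
    pure (mid k) i j = 0.
  move=> kc; rewrite negb_and => ij; apply: pure_eq0.
  have ic1 : (i <= c.+1)%N by lia.
  rewrite (nth_mid k ic1); case: leqP ij => //= _ _.
  by rewrite /upper; apply/eqP => ej; lia.
case: (boolP ((i < c)%N && (j == (top i)%:Z))) => [/andP[ic' /eqP jt]|nij].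
  rewrite (@big_cat_nat _ _ _ i) /=; [|lia|lia].
  rewrite [X in X + _]big_nat [X in X + _]big1 ?add0r => [|k ki]; last first.
    rewrite mid0 ?mulr0 //; first by lia.
    by rewrite negb_and -ltnNge; apply/orP; left; lia.
  rewrite jt G_top // -mulrA -sum_pure_mid // mulr_sumr.
  by apply: eq_bigr => k _; rewrite mulrA.
rewrite G_eq0 ?mul0r //; last by lia.
rewrite big_nat big1 // => k kc; rewrite mid0 ?mulr0 //.
by apply: contra nij => /andP[ik ->]; rewrite andbT; lia.
Qed.

(** Duality exchanges Phases 1 and 3 and reverses Phase 2, whose coefficients are symmetric by
    [w_dual]. *)
Lemma T_dual (i : nat) (j : int) :
  (i <= c.+1)%N -> T (c.+1 - i)%N (D%:Z - j) = T i j.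
Proof.
move=> ic; have ci := leq_subr i c.+1.
have dlong k j' (s : nat) : (k <= c.+1)%N -> (1 <= s <= eps)%N ->
    pure (dual (long s)) k j' = pure (long s) (c.+1 - k)%N (D%:Z - j').
  move=> kc sl; rewrite (pure_dual _ (size_long sl)) //.
  by rewrite (nth_long sl (leqnn _)) ltnn.
have sum3 (x1 x2 x3 y1 y2 y3 : rat) :
  x1 = y3 -> x2 = y2 -> x3 = y1 -> x1 + x2 + x3 = y1 + y2 + y3.
  by move=> -> -> ->; ring.
apply: sum3; last 1 first.
- apply: eq_big_nat => s sl; rewrite dlong // subKn //.
  by congr (_ * pure _ _ _); lia.
- by apply: eq_big_nat => s sl; rewrite dlong.
rewrite big_nat_rev /=; apply: eq_big_nat => k kc.
have -> : (1 + c - k.+1 = c - k)%N by lia.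
rewrite w_dual; last by lia.
have smid : size (mid k) = c.+2 by rewrite size_mkseq.
rewrite -dual_mid; last by lia.
rewrite (pure_dual _ smid) // subKn //; congr (_ * pure _ _ _).
rewrite (nth_mid k (leqnn _)) (_ : c < k = false)%N; last by lia.
by rewrite upperc; lia.
Qed.

Lemma T_col0 (j : int) : j != 0 -> T 0 j = 0.
Proof.
move=> j0; rewrite /T !big_nat !big1 ?addr0 // => s sl.
- rewrite pure_eq0 ?mulr0 // nth_dual_long // subn0 nth_long // ltnn subrr.
  exact: j0.
- by rewrite pure_eq0 ?mulr0 // (nth_mid s (leq0n _)) /= top0.
rewrite pure_eq0 ?mulr0 // nth_long //=.
have /andP[ge0 le_top] := degs_range sl (leq0n c).
by rewrite top0 in le_top; apply: contra j0 => /eqP ->; rewrite eq_le ge0 le_top.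
Qed.

Lemma betti_col0 (j : int) : j != 0 -> betti c.+1 a 0 j = 0.
Proof.
move=> j0; apply/eqP/negPn/negP => /(betti_neq0 _)[|_ ge0].
  by move=> t tc; apply: a_le; lia.
by rewrite subn0 subrr => le0; move: j0; rewrite eq_le ge0 le0.
Qed.

Lemma T_inner (i : nat) (j : int) :
  (1 <= i <= c)%N -> T i j = betti c.+1 a i j.
Proof.
move=> ic; case: (ltP j al%:Z) => jal; first exact: T_low.
have ic1 : (i <= c.+1)%N by lia.
(* Since [A < al], a degree at least [al] reflects to one at most [A], which is low. *)
rewrite -T_dual // -(betti_dual a j ic1) T_low //; first by lia.
by have := a_sum; rewrite D_E -/A -/al; lia.
Qed.

Lemma moment_T (f : {poly rat}) :
  (size f <= c.+1)%N -> moment c.+1 D.+1 f T = 0.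
Proof.
move=> sf; rewrite 2!momentD.
rewrite (moment_sum _ _ _ _ _ (fun s i j => y s * pure (long s) i j)).
rewrite (moment_sum _ _ _ _ _ (fun s i j => w s * pure (mid s) i j)).
rewrite (moment_sum _ _ _ _ _ (fun s i j => y s * pure (dual (long s)) i j)).
rewrite !big_nat !big1 ?addr0 // => s sl; rewrite momentZ moment_pure ?mulr0 //.
- exact/degree_sequence_dual/degree_sequence_long.
- move=> i ic; rewrite nth_dual_long //.
  by have := @long_range s (c.+1 - i) sl (leq_subr _ _); lia.
- by apply: degree_sequence_mid; lia.
- move=> i ic; rewrite nth_mid //.
  case: leqP => _; first by have := top_le i; rewrite D_E; lia.
  have ic' : (i.-1 <= c)%N by lia.
  by have := degsum_le a ic'; rewrite -upperc /upper; lia.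
- exact: degree_sequence_long.
by move=> i ic; have := long_range sl ic; lia.
Qed.

(** The difference [E] can live only at the corners [(0, 0)] and [(c.+1, D)], and duality makes its
    two values equal. *)
Lemma betti_T (i : nat) (j : int) : betti c.+1 a i j = T i j.
Proof.
pose E : diagram := fun i j => T i j + (-1) * betti c.+1 a i j.
suff E0 i' j' : E i' j' = 0.
  by apply/eqP; rewrite eq_sym -subr_eq0 -mulN1r; apply/eqP; apply: E0.
have Edual k j0 : (k <= c.+1)%N -> E (c.+1 - k)%N (D%:Z - j0) = E k j0.
  by move=> kc; rewrite /E T_dual // betti_dual.
have Ecol0 j0 : j0 != 0 -> E 0 j0 = 0.
  by move=> j00; rewrite /E T_col0 // betti_col0 // mulr0 addr0.
have Einner k j0 : (1 <= k <= c)%N -> E k j0 = 0.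
  by move=> kc; rewrite /E T_inner // mulN1r subrr.
have Elast : E c.+1 D%:Z = 0.
  (* The polynomial ['X] kills the corner in degree 0 and weights the other by [D]. Its degree 1 is
     below [c.+1], so [T] and the Betti diagram both have zero moment. *)
  have : moment c.+1 D.+1 'X E = 0.
    rewrite momentD momentZ moment_T ?size_polyX //; last by lia.
    rewrite moment_betti // sum_sign_horner ?size_polyX //.
    rewrite coefX (_ : (c.+1 == 1)%N = false) /=; last by lia.
    by rewrite !mulr0 addr0.
  rewrite (@moment_col _ _ _ _ (fun k => if k == 0%N then 0%N else D)).
  - rewrite big_ord_recr big_ord_recl /= hornerX mulr0 mul0r add0r.
    rewrite big1 ?add0r => [|k _].
      move=> /eqP; rewrite !mulf_eq0 signr_eq0 hornerX pnatr_eq0.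
      rewrite (_ : D == 0%N = false) /=; first by move/eqP.
      by rewrite D_E /al; have := a_gt0 (t := c.+1); lia.
    by rewrite Einner ?mulr0 // /bump leq0n add1n /= ltn_ord.
  - by move=> k _; case: ifP.
  move=> k j0 kc; have [->|k0] := eqVneq k 0%N => j0d.
    by rewrite Ecol0 ?mulr0.
  have [kc'|kc'] := leqP k c; first by rewrite Einner ?mulr0 //; lia.
  rewrite -Edual // (_ : c.+1 - k = 0)%N; last by lia.
  by rewrite Ecol0 ?mulr0 // subr_eq0 eq_sym.
have Elast_col j0 : E c.+1 j0 = 0.
  have [->//|j0D] := eqVneq j0 D%:Z.
  by rewrite -Edual // subnn Ecol0 // subr_eq0 eq_sym.
have [i0|i0] := eqVneq i' 0%N.
  by rewrite i0 -Edual // subn0.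
have [ic|ic] := leqP i' c; first by rewrite Einner //; lia.
have [->//|ic'] := eqVneq i' c.+1.
rewrite /E; case: (eqVneq (betti c.+1 a i' j') 0) => [->|]; last first.
  move=> /(betti_neq0 _) []; last by lia.
  by move=> t tc; apply: a_le; lia.
have col0 d : size d = c.+2 -> pure d i' j' = 0.
  by move=> sd; rewrite /pure sd (_ : i' < c.+2 = false)%N //; lia.
rewrite mulr0 addr0 /T !big_nat !big1 ?addr0 // => s sl; rewrite col0 ?mulr0 //.
- by rewrite size_dual size_long.
- by rewrite size_mkseq.
exact: size_long.
Qed.

Hypothesis r_lt : forall s, (1 <= s <= eps)%N -> r s / coef l s < al%:R.

Lemma y_gt0 (s : nat) : (1 <= s <= eps)%N -> 0 < y s.
Proof.
by move=> sl; rewrite subr_gt0 -ltr_pdivrMr ?r_lt // (bs_coef_gt0 l_bs).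
Qed.

(** * The candidate as a run of the New Algorithm *)

Let N := last_step c l.
Let e (s : nat) : seq int := new_degs c a l s.

Lemma N_E : N = (2 * eps + c - 1)%N.
Proof. by []. Qed.

Lemma long_last : long eps = mid c.
Proof.
have e1 := size_l_gt0; have el : (1 <= eps <= eps)%N by lia.
apply: (@eq_from_nth _ 0) => [|i]; rewrite size_long ?size_mkseq // => ic.
rewrite nth_long // nth_mid //; case: leqP => ci; first exact: degs_last.
by rewrite (_ : i.-1 = c) ?upperc //; lia.
Qed.

Lemma phase2_mid (k : nat) : (k < c)%N -> phase2_degs c a l k = mid (c - k).
Proof.
elim: k => [|k IH] kc; first by rewrite subn0 -long_last.
rewrite /= IH; last exact: ltnW.
have sz : size (set_nth 0 (mid (c - k)) (c - k.+1 + 1)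
    (degsum a (c - k.+1) + a c.+1)%N%:Z) = c.+2.
  by rewrite size_set_nth size_mkseq; apply/maxn_idPr; lia.
apply: (@eq_from_nth _ 0) => [|i]; rewrite sz ?size_mkseq // => ic.
rewrite nth_set_nth /= !nth_mid //; case: eqP => ik.
  rewrite (_ : (i <= c - k.+1)%N = false); last by lia.
  by rewrite /upper addnC; congr (_ + degsum a _)%N%:Z; lia.
by rewrite (_ : (i <= c - k)%N = (i <= c - k.+1)%N) //; apply/idP/idP; lia.
Qed.

Lemma new_degs_low (s : nat) : (s <= eps)%N -> e s = long s.
Proof. by move=> sl; rewrite /e /new_degs sl. Qed.

Lemma new_degs_high (t : nat) :
  (1 <= t <= eps)%N -> e (N + 1 - t) = dual (long t).
Proof.
move=> tl; have NE := N_E; rewrite /e /new_degs -/eps -/N.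
rewrite (_ : (_ <= eps)%N = false); last by lia.
rewrite (_ : (_ < eps + c)%N = false); last by lia.
by rewrite (_ : N + 1 - (N + 1 - t) = t)%N //; lia.
Qed.

(** The range includes [k = 0] and [k = c], so the passages between phases count as Phase 2
    steps. *)
Lemma new_degs_mid (k : nat) : (k <= c)%N -> e (eps + k) = mid (c - k).
Proof.
move=> kc; have e1 := size_l_gt0; have NE := N_E.
have [->|k0] := eqVneq k 0%N.
  by rewrite addn0 new_degs_low // long_last subn0.
have [->|kc'] := eqVneq k c.
  rewrite (_ : eps + c = N + 1 - eps)%N; last by lia.
  by rewrite new_degs_high ?long_last ?dual_mid //; lia.
rewrite /e /new_degs -/eps (_ : (_ <= eps)%N = false); last by lia.
rewrite (_ : (_ < eps + c)%N); last by lia.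
rewrite (_ : eps + k - eps = k)%N; last by lia.
by apply: phase2_mid; lia.
Qed.

Let Y (s : nat) : rat :=
  if (s <= eps)%N then y s
  else if (s < eps + c)%N then w (c - (s - eps)) else y (N + 1 - s).

(** In Phase 3 the step from [N - t] to its successor passes from the dual of [long t.+1] to that of
    [long t], so the moving column is the reflection of the column of [pos t]. *)
Let P (s : nat) : position :=
  if (s <= eps)%N then pos s
  else if (s < eps + c)%N then ((c - (s - eps))%N, (e s)`_(c - (s - eps)))
  else if (s < N)%N then
    ((c.+1 - (pos (N - s)).1)%N, (e s)`_(c.+1 - (pos (N - s)).1))
  else (0%N, 0).

Lemma Y_gt0 (s : nat) : (1 <= s <= N)%N -> 0 < Y s.
Proof.
have NE := N_E; move=> sl; rewrite /Y.
case: (leqP s eps) => se; first by apply: y_gt0; lia.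
by case: (ltnP s (eps + c)) => sc; [apply: w_gt0|apply: y_gt0; lia].
Qed.

Variant step_spec : nat -> seq int -> seq int -> Prop :=
| StepLow s of (1 <= s < eps)%N : step_spec s (long s) (long s.+1)
| StepMid k of (k < c)%N : step_spec (eps + k) (mid (c - k)) (mid (c - k.+1))
| StepHigh t of (1 <= t < eps)%N :
    step_spec (N - t) (dual (long t.+1)) (dual (long t)).

Lemma stepP (s : nat) : (1 <= s < N)%N -> step_spec s (e s) (e s.+1).
Proof.
move=> sN; have NE := N_E; have e1 := size_l_gt0.
case: (ltnP s eps) => se.
  by rewrite !new_degs_low // ?(ltnW se) //; apply: StepLow; lia.
case: (ltnP s (eps + c)) => sc.
  have [k sk] : exists k, s = (eps + k)%N by exists (s - eps)%N; lia.
  subst s; rewrite -addnS !new_degs_mid; [|lia|lia].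
  by apply: StepMid; lia.
have [t st] : exists t, s = (N - t)%N by exists (N - s)%N; lia.
subst s; have tl : (1 <= t < eps)%N by lia.
rewrite (_ : (N - t).+1 = N + 1 - t)%N; last by lia.
rewrite [e (N - t)](_ : _ = e (N + 1 - t.+1)); last by congr e; lia.
by rewrite !new_degs_high; [exact: StepHigh|lia|lia].
Qed.

Lemma e_degree_sequence (s : nat) :
  (1 <= s <= N)%N -> degree_sequence c.+1 (e s).
Proof.
move=> sN; have NE := N_E; have e1 := size_l_gt0.
have [sN'|sN'] := ltnP s N.
  have : (1 <= s < N)%N by lia.
  case/stepP => {sN sN'} [s' sl|k kc|t tl].
  - by apply: degree_sequence_long; lia.
  - by apply: degree_sequence_mid; lia.
  - by apply/degree_sequence_dual/degree_sequence_long; lia.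
have -> : s = (N + 1 - 1)%N by lia.
by rewrite new_degs_high; [apply/degree_sequence_dual/degree_sequence_long|]; lia.
Qed.

Lemma P_mid (k : nat) :
  (k < c)%N -> P (eps + k) = ((c - k)%N, (top (c - k))%:Z).
Proof.
move=> kc; rewrite /P; have [->|k0] := eqVneq k 0%N.
  by rewrite addn0 leqnn pos_l.2 subn0 topc.
rewrite (_ : (_ <= eps)%N = false); last by lia.
rewrite (_ : (_ < eps + c)%N); last by lia.
rewrite (_ : eps + k - eps = k)%N; last by lia.
by rewrite new_degs_mid ?nth_mid ?leqnn //; lia.
Qed.

Lemma P_high (t : nat) : (1 <= t < eps)%N ->
  P (N - t) = ((c.+1 - (pos t).1)%N, (dual (long t.+1))`_(c.+1 - (pos t).1)).
Proof.
move=> tl; have NE := N_E; rewrite /P.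
rewrite (_ : (_ <= eps)%N = false); last by lia.
rewrite (_ : (_ < eps + c)%N = false); last by lia.
rewrite (_ : (_ < N)%N); last by lia.
rewrite (_ : N - (N - t) = t)%N; last by lia.
by rewrite -new_degs_high; [congr (_, (e _)`_ _)|]; lia.
Qed.

Lemma P_last : P N = (0%N, 0).
Proof.
have NE := N_E; have e1 := size_l_gt0; rewrite /P ltnn.
rewrite (_ : (_ <= eps)%N = false); last by lia.
by rewrite (_ : (_ < eps + c)%N = false) //; lia.
Qed.

Lemma P_step (s : nat) : (1 <= s < N)%N ->
  [/\ ((P s).1 <= c.+1)%N, (P s).2 = (e s)`_(P s).1,
      forall i, (i <= c.+1)%N -> i <> (P s).1 -> (e s.+1)`_i = (e s)`_i
    & (e s)`_(P s).1 < (e s.+1)`_(P s).1].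
Proof.
move=> sN; have e1 := size_l_gt0.
case: (stepP sN) => {s sN} [s sl|k kc|t tl].
- have sl' : (1 <= s <= eps)%N by lia.
  have sl1 : (1 <= s.+1 <= eps)%N by lia.
  have pc := pos_col sl'; have pc1 := leqW pc.
  rewrite /P (_ : (s <= eps)%N) ?(nth_long _ pc1) ?pc //; last by lia.
  rewrite -pos_deg //; split=> // [i ic ip|].
    rewrite !nth_long //; case: leqP => // ic'; exact: degs_const_l.
  by rewrite pos_deg // degs_incr_l.
- rewrite P_mid //=; have ck : (c - k <= c.+1)%N by lia.
  rewrite !(nth_mid _ ck) leqnn (_ : (c - k <= c - k.+1)%N = false); last by lia.
  split=> // [i ic ip|]; last by rewrite ltz_nat top_lt_upper.
  by rewrite !nth_mid //; congr (if _ then _ else _); apply/idP/idP; lia.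
have tl0 : (1 <= t <= eps)%N by lia.
have tl1 : (1 <= t.+1 <= eps)%N by lia.
have pc := pos_col tl0; have pc1 := leqW pc.
rewrite P_high //=; have cp := leq_subr (pos t).1 c.+1.
split=> // [i ic ip|]; rewrite !nth_dual_long // ?subKn // !nth_long ?leq_subr //.
  case: (leqP _ c) => // ic'; rewrite degs_const_l //; lia.
by rewrite pc ltrD2l ltrN2 degs_incr_l.
Qed.

Lemma P_col (s : nat) : (1 <= s <= N)%N -> ((P s).1 <= c.+1)%N.
Proof.
move=> sN; have [->|sN'] := eqVneq s N; first by rewrite P_last.
by have [] := @P_step s ltac:(lia).
Qed.

Lemma P_deg (s : nat) : (1 <= s <= N)%N -> (P s).2 = (e s)`_(P s).1.
Proof.
move=> sN; have [->|sN'] := eqVneq s N; last by have [] := @P_step s ltac:(lia).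
have NE := N_E; have e1 := size_l_gt0.
rewrite P_last /= [N in e N](_ : N = N + 1 - 1)%N; last by lia.
rewrite new_degs_high // nth_dual_long // subn0 nth_long // ltnn subrr.
by [].
Qed.

Lemma P_designated (s : nat) : (1 <= s <= N)%N -> designated c a l pos s (P s).
Proof.
move=> sN; have NE := N_E.
have := @P_step s; rewrite /designated /P -/eps -/N -/e.
case: ifP => // se; case: ifP => // sc; case: ifP => // sN'.
move=> /(_ ltac:(lia)) [pc pd cst inc]; split=> // i ic.
split=> [ne|->].
  by apply/eqP/negPn/negP => /eqP ip; apply: ne; rewrite cst.
by apply/eqP; rewrite lt_eqF.
Qed.

Lemma betti_new_degs (i : nat) (j : int) :
  betti c.+1 a i j = \sum_(1 <= s < N.+1) Y s * pure (e s) i j.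
Proof.
have NE := N_E; have e1 := size_l_gt0; rewrite betti_T /T.
rewrite [RHS](@big_cat_nat _ _ _ eps.+1) /=; [|lia|lia].
rewrite [X in _ = _ + X](@big_cat_nat _ _ _ (eps + c)) /=; [|lia|lia].
rewrite addrA; congr (_ + _ + _).
- rewrite big_nat [RHS]big_nat.
  apply: eq_bigr => s sl; have se : (s <= eps)%N by lia.
  by rewrite new_degs_low // /Y se.
(* The middle sum of [T] runs through [mid] upwards and the chain runs through it downwards, hence
   the reversal. *)
- rewrite -[eps.+1]add1n [(eps + c)%N]addnC big_addn addnK big_nat_rev /=.
  apply: eq_big_nat => k kc.
  have -> : (1 + c - k.+1 = c - k)%N by lia.
  rewrite addnC new_degs_mid; last by lia.
  rewrite /Y (_ : (_ <= eps)%N = false); last by lia.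
  rewrite (_ : (_ < eps + c)%N); last by lia.
  by rewrite (_ : eps + k - eps = k)%N //; lia.
rewrite (_ : eps + c = 1 + (eps + c).-1)%N; last by lia.
rewrite big_addn (_ : N.+1 - _ = eps.+1)%N; last by lia.
rewrite [RHS]big_nat_rev /=; apply: eq_big_nat => t tl.
rewrite (_ : 1 + eps.+1 - t.+1 + (eps + c).-1 = N + 1 - t)%N; last by lia.
rewrite new_degs_high // /Y (_ : (_ <= eps)%N = false); last by lia.
rewrite (_ : (_ < eps + c)%N = false); last by lia.
by rewrite (_ : N + 1 - (N + 1 - t) = t)%N //; lia.
Qed.

(** Phase 2 is never skipped here, since [a c <= A < a c.+1]. *)
Lemma new_steps_iota : new_steps c a l = iota 1 N.
Proof.
have NE := N_E; have e1 := size_l_gt0; rewrite /new_steps -/eps.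
rewrite (_ : (a c == a c.+1) = false); last first.
  apply/eqP => ac; have := a_sum; rewrite -ac.
  by rewrite (_ : c = c.-1.+1) ?degsumS; lia.
rewrite (_ : N = eps + (c.-1 + eps))%N; last by lia.
by rewrite !iotaD; congr (_ ++ (_ ++ iota _ _)); lia.
Qed.

Lemma new_algorithm_bs :
  exists2 out : decomposition,
    new_algorithm c a l pos out & bs_decomposition c.+1 (betti c.+1 a) out.
Proof.
have P_const s i : (1 <= s < N)%N -> (i <= c.+1)%N -> i <> (P s).1 ->
    (e s.+1)`_i = (e s)`_i by move=> sN; have [_ _ + _] := P_step sN; apply.
have P_incr s : (1 <= s < N)%N -> (e s)`_(P s).1 < (e s.+1)`_(P s).1.
  by move=> sN; have [] := P_step sN.
exists (mkseq (fun n => (Y n.+1, e n.+1)) N); last first.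
  exact: (chain_bs e_degree_sequence Y_gt0 P_col P_deg P_const P_incr betti_new_degs).
rewrite /new_algorithm new_steps_iota size_iota size_mkseq; split=> // n nN.
rewrite nth_iota; last by lia.
rewrite (_ : 1 + n.-1 = n)%N; last by lia.
split; first exact: degs_chain.
exists (P n); first exact: P_designated.
move=> z; exact: (chain_coef_unique e_degree_sequence P_col P_deg P_const P_incr
  betti_new_degs).
Qed.

End NewDecomposition.

Theorem corollary2p12 (c : nat) (a : nat -> nat) (l : decomposition)
    (pos : nat -> position) (r : nat -> rat)
    (c_gt1 : (1 < c)%N)
    (a_gt0 : forall t, (1 <= t <= c.+1)%N -> (0 < a t)%N)
    (a_le : forall t, (1 <= t <= c)%N -> (a t <= a t.+1)%N)
    (l_bs : bs_decomposition c (betti c a) l)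
    (no_mass : ~ mass_elimination (betti c a) l)
    (pos_l : elimination_positions c a l pos)
    (r_l : remainders c a l pos r)
    (a_large :
      \big[Num.max/(degsum a c)%:R]_(1 <= s < (size l).+1) (r s / coef l s)
        < (a c.+1)%:R) :
  exists2 out : decomposition,
    new_algorithm c a l pos out &
    bs_decomposition c.+1 (betti c.+1 a) out.
Proof.
have a_sum : (degsum a c < a c.+1)%N.
  rewrite -(ltr_nat rat); apply: le_lt_trans a_large.
  exact: bigmax_ge_id.
have r_lt s : (1 <= s <= size l)%N -> r s / coef l s < (a c.+1)%:R.
  move=> sl; apply: le_lt_trans a_large.
  by apply: le_bigmax_seq => //; rewrite mem_index_iota; lia.
exact: new_algorithm_bs c_gt1 a_gt0 a_le l_bs no_mass pos_l r_l a_sum r_lt.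
Qed.
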